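(* For every $\epsilon \in (0,1)$, the $\epsilon$-mixing time $T_{\rm mix}^{(n)}(\epsilon)$ of the random-to-random insertion shuffle on $n$ cards satisfies $$\limsup_{n \to \infty} \frac{T_{\rm mix}^{(n)}(\epsilon)}{1.5324\, n \log n} \leq 1 .$$
   Context: The random-to-random insertion shuffle on $n$ cards is the Markov chain on the symmetric group $S_n$ (the set of orderings of a deck of $n$ cards labelled $1,\dots,n$, where a permutation $\pi$ is identified with the ordering in which $\pi(c)$ is the position of card $c$) with the following transition rule: at each step choose one of the $n$ cards uniformly at random, remove it from the deck, and re-insert it into one of the $n$ possible positions, chosen uniformly at random independently of the card. Equivalently: choose $a$ and $b$ independently and uniformly from $\{1,\dots,n\}$; remove card $a$ and re-insert it immediately to the right of card $b$ if $a \neq b$, and at the leftmost position if $a=b$. Let $P$ be its transition matrix and $\mathcal{U}$ the uniform distribution on $S_n$. For probability measures $\mu,\nu$ on a finite set $V$, the total variation distance is $\|\mu-\nu\| = \frac12 \sum_{x\in V} |\mu(x)-\nu(x)|$. For $\epsilon\in(0,1)$, the $\epsilon$-mixing time is $$T_{\rm mix}^{(n)}(\epsilon) = \min\{t \geq 0 : \|P^t(x,\cdot) - \mathcal{U}\| \leq \epsilon \text{ for all } x \in S_n\}.$$ Here $\log$ is the natural logarithm. *)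

(* Defs.v *)
From mathcomp Require Import all_boot all_order all_algebra all_fingroup.
From mathcomp Require Import boolp classical_sets reals ereal topology.
From mathcomp Require Import normedtype sequences exp.

Set Implicit Arguments.
Unset Strict Implicit.
Unset Printing Implicit Defensive.

Import Order.TTheory GRing.Theory Num.Theory.
Local Open Scope ring_scope.

Section MarkovChain.
Variables (R : realType) (V : finType).

Fixpoint kernel_pow (P : V -> V -> R) (t : nat) (x y : V) : R :=
  if t is t'.+1 then \sum_(z : V) P x z * kernel_pow P t' z y
  else (x == y)%:R.

Definition tv_dist (mu nu : V -> R) : R :=
  2^-1 * \sum_(x : V) `|mu x - nu x|.

Definition uniform_dist : V -> R := fun=> #|V|%:R^-1.

Definition mixed (P : V -> V -> R) (eps : R) (t : nat) : bool :=
  [forall x : V, tv_dist (kernel_pow P t x) uniform_dist <= eps].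

(* The value is +oo when the chain never gets within eps of uniformity. *)
Definition mixing_time (P : V -> V -> R) (eps : R) : \bar R :=
  if pselect (exists t, mixed P eps t) is left h then (ex_minn h)%:R%:E
  else +oo%E.

End MarkovChain.

(* The permutation of positions caused by moving whatever lies at position i *)
(* to position j: lift_perm i j 1 sends i to j and is increasing from the    *)
(* complement of i onto the complement of j.                                 *)
Definition move_position (n : nat) : 'I_n -> 'I_n -> 'S_n :=
  if n is m.+1 then fun i j => lift_perm i j 1%g else fun _ _ => 1%g.

(* An ordering s maps each card to its position, 0 being the leftmost one,   *)
(* and (s * u)%g c = u (s c).                                                *)
Definition reinsert (n : nat) (s : 'S_n) (c j : 'I_n) : 'S_n :=
  (s * move_position (s c) j)%g.

Definition random_to_random (R : realType) (n : nat) (s u : 'S_n) : R :=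
  #|[set cj : 'I_n * 'I_n | reinsert s cj.1 cj.2 == u]|%:R / (n ^ 2)%:R.

(* Main.v *)
Require Import Defs.
From mathcomp Require Import all_boot all_order all_algebra all_fingroup.
From mathcomp Require Import boolp classical_sets reals ereal topology.
From mathcomp Require Import normedtype sequences exp.
From mathcomp Require Import derive finset.
From mathcomp Require Import ring lra zify.
Import Order.TTheory GRing.Theory Num.Theory.
Local Open Scope ring_scope.

Set Implicit Arguments.
Unset Strict Implicit.
Unset Printing Implicit Defensive.

(** The proof is an L2 argument, which yields the constant 3/2 in place of
    1.5324.

    Write [N] for the number of cards, [P] for the transition matrix and [T] for
    the sum of all transpositions, both acting on functions on the symmetric
    group through the right regular representation.  Removing a card and
    reinserting it is the same as moving it to the end of the deck and then from
    the end to its new place, so [N^2 P = B B^T], where [B] is the sum of the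
    cycles moving a position to the end.

    The heart of the proof is a comparison with random transpositions:
    [N^2 P <= N (N + 1) / 2 + T] as quadratic forms ([to_last_le]).  It goes by
    induction on [N]: in the opposite order, [B^T B] equals [N] plus a
    Jucys-Murphy element plus the generator for [N - 1] cards with one
    transposition inserted in its middle ([to_last_commutation]), and removing
    that transposition only enlarges the form.  Hence [B^T B <= H] for the right
    hand side [H], and as [H] commutes with [B] the bound passes to [B B^T].

    It remains to bound [T].  Split the functions by degree, where a function
    has degree at most [d] if it is a combination of functions of the contents
    of [d] positions.  In degree exactly [d] there are two lower bounds for
    [N (N - 1) / 2 - T]:
    - [d (N - d + 1)] ([transp_degree]), because an eigenfunction may be
      symmetrized over [N - d] positions, whereas symmetrizing it over one
      position more kills it;
    - [N d / 2] ([transp_high_degree]), because every star of transpositions is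
      at most [N - d - 1].  This is the classical statement that the contents of
      a Young diagram are smaller than the length of its first row, and it is
      obtained here from the relation of the degenerate affine Hecke algebra
      between two stars ([star_high_degree]).

    By transitivity of the left action, four times the squared total variation
    distance at time [t] is at most the trace of [P^(2 t)] minus 1.  The degree
    [d] part has dimension at most [C(N, d) N^d], so for [2 t >= 3 N ln N] its
    share of the trace is at most [N^(2 d) N^(- 9 d / 4)] for [d <= N / 4] and
    at most [2^N N^d N^(- 3 d / 2)] for the other degrees.  Both are at most
    [N^(- d / 4)] for large [N], and the sum over [d >= 1] tends to 0. *)

(** * Quadratic forms on row vectors *)

Section Dot.
Context {R : realType}.

Definition dot (n : nat) (u v : 'rV[R]_n) : R := (u *m v^T) 0 0.

Lemma dotE n (u v : 'rV[R]_n) : dot u v = \sum_j u 0 j * v 0 j.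
Proof. by rewrite /dot !mxE; apply: eq_bigr => j _; rewrite mxE. Qed.

Lemma dotC n (u v : 'rV[R]_n) : dot u v = dot v u.
Proof. by rewrite !dotE; apply: eq_bigr => j _; rewrite mulrC. Qed.

Lemma dotDl n (u v w : 'rV[R]_n) : dot (u + v) w = dot u w + dot v w.
Proof. by rewrite /dot mulmxDl mxE. Qed.

Lemma dotDr n (u v w : 'rV[R]_n) : dot w (u + v) = dot w u + dot w v.
Proof. by rewrite dotC dotDl !(dotC w). Qed.

Lemma dotNl n (u w : 'rV[R]_n) : dot (- u) w = - dot u w.
Proof. by rewrite /dot mulNmx mxE. Qed.

Lemma dotNr n (u w : 'rV[R]_n) : dot w (- u) = - dot w u.
Proof. by rewrite dotC dotNl (dotC w). Qed.

Lemma dotZl n a (u w : 'rV[R]_n) : dot (a *: u) w = a * dot u w.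
Proof. by rewrite /dot -scalemxAl mxE. Qed.

Lemma dotZr n a (u w : 'rV[R]_n) : dot w (a *: u) = a * dot w u.
Proof. by rewrite dotC dotZl (dotC w). Qed.

Lemma dot0l n (u : 'rV[R]_n) : dot 0 u = 0.
Proof. by rewrite /dot mul0mx mxE. Qed.

Lemma dot0r n (u : 'rV[R]_n) : dot u 0 = 0.
Proof. by rewrite dotC dot0l. Qed.

Lemma dot_sumr n I (r : seq I) (P : pred I) (F : I -> 'rV[R]_n) u :
  dot u (\sum_(i <- r | P i) F i) = \sum_(i <- r | P i) dot u (F i).
Proof.
apply: (big_morph (dot u)) => [x y|]; [exact: dotDr|exact: dot0r].
Qed.

Lemma dot_suml n I (r : seq I) (P : pred I) (F : I -> 'rV[R]_n) u :
  dot (\sum_(i <- r | P i) F i) u = \sum_(i <- r | P i) dot (F i) u.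
Proof. by rewrite dotC dot_sumr; apply: eq_bigr => i _; rewrite dotC. Qed.

Lemma dot_adj n p (u : 'rV[R]_n) (v : 'rV[R]_p) (M : 'M[R]_(n, p)) :
  dot (u *m M) v = dot u (v *m M^T).
Proof. by rewrite /dot trmx_mul trmxK mulmxA. Qed.

Lemma dot_adjT n p (u : 'rV[R]_n) (v : 'rV[R]_p) (M : 'M[R]_(p, n)) :
  dot (u *m M^T) v = dot u (v *m M).
Proof. by rewrite dot_adj trmxK. Qed.

Lemma dot_ge0 n (u : 'rV[R]_n) : 0 <= dot u u.
Proof. by rewrite dotE; apply: sumr_ge0 => j _; rewrite -expr2 sqr_ge0. Qed.

Lemma dot_eq0 n (u : 'rV[R]_n) : (dot u u == 0) = (u == 0).
Proof.
apply/idP/eqP => [|->]; last by rewrite dot0l.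
rewrite dotE psumr_eq0; last by move=> j _; rewrite -expr2 sqr_ge0.
move=> /allP u0; apply/rowP => j; rewrite mxE.
by have := u0 j; rewrite mem_index_enum -expr2 sqrf_eq0 => /(_ isT)/eqP.
Qed.

Lemma dot_gt0 n (u : 'rV[R]_n) : (0 < dot u u) = (u != 0).
Proof. by rewrite lt_neqAle dot_ge0 andbT eq_sym dot_eq0. Qed.

Let linear_term_eq0 (b c : R) :
  0 <= c -> (forall t, 0 <= t * (2 * b + t * c)) -> b = 0.
Proof.
move=> c0 q.
(* evaluate near the minimiser - b / c, shifted so that c may vanish *)
have c1 : 0 < 1 + c by lra.
have E : - b / (1 + c) * (2 * b + - b / (1 + c) * c)
       = - ((b / (1 + c)) ^+ 2 * (2 + c)) by field; lra.
have := q (- b / (1 + c)); rewrite E oppr_ge0 pmulr_lle0; last by lra.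
move=> h; have : (b / (1 + c)) ^+ 2 == 0 by rewrite eq_le h sqr_ge0.
by rewrite sqrf_eq0 mulf_eq0 invr_eq0 (gt_eqF c1) orbF => /eqP.
Qed.

Lemma dot_cauchy n (u v : 'rV[R]_n) : dot u v ^+ 2 <= dot u u * dot v v.
Proof.
have [->|v0] := eqVneq v 0; first by rewrite !dot0r mulr0 expr0n.
have vv : 0 < dot v v by rewrite dot_gt0.
have := dot_ge0 (dot v v *: u - dot u v *: v).
rewrite !(dotDl, dotDr, dotNl, dotNr, dotZl, dotZr) (dotC v u).
move=> h; rewrite -subr_ge0 -(pmulr_rge0 _ vv); apply: le_trans h _.
by rewrite le_eqVlt; apply/orP; left; apply/eqP; ring.
Qed.

(** An isotropic vector [u] of a form [q] that is nonnegative on a subspace lies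
    in the radical: otherwise [t |-> q (u + t v)] would be negative near 0. *)
Lemma psd_isotropic n p (C : 'M[R]_(n, p)) (M : 'M[R]_n) u v :
    M^T = M -> u *m C = 0 -> v *m C = 0 ->
    (forall w, w *m C = 0 -> 0 <= dot (w *m M) w) ->
  dot (u *m M) u = 0 -> dot (u *m M) v = 0.
Proof.
move=> sM uC vC psd u0.
apply: (@linear_term_eq0 _ (dot (v *m M) v)) => [|t]; first exact: psd.
have := psd (u + t *: v); rewrite mulmxDl uC -scalemxAl vC scaler0 addr0.
move=> /(_ erefl); rewrite mulmxDl -scalemxAl !(dotDl, dotDr, dotZl, dotZr).
rewrite u0 (_ : dot (v *m M) u = dot (u *m M) v); last first.
  by rewrite dot_adj sM dotC.
by congr (_ <= _); ring.
Qed.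

End Dot.

Section Extremal.
Context {R : realType}.
Import numFieldNormedType.Exports.
Local Open Scope classical_set_scope.

Lemma continuous_sumr (T : topologicalType) k (F : 'I_k -> T -> R) :
  (forall i, continuous (F i)) -> continuous (fun x => \sum_i F i x).
Proof.
move=> cF x; elim: k F cF => [|k IH] F cF.
  rewrite (_ : (fun _ => _) = fun=> 0); first exact: cst_continuous.
  by apply/funext => y; rewrite big_ord0.
rewrite (_ : (fun _ => _) =
    (fun y => F ord0 y + \sum_(i < k) F (lift ord0 i) y)); last first.
  by apply/funext => y; rewrite big_ord_recl.
apply: cvgD; first exact: cF.
by apply: (IH (fun i => F (lift ord0 i))) => i; exact: cF.
Qed.

Lemma continuous_mulr (T : topologicalType) (f g : T -> R) :
  continuous f -> continuous g -> continuous (fun x => f x * g x).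
Proof. by move=> cf cg x; apply: cvgM; [exact: cf|exact: cg]. Qed.

Lemma continuous_quadratic n (M : 'M[R]_n) :
  continuous (fun u : 'rV[R]_n => dot (u *m M) u).
Proof.
rewrite (_ : (fun u : 'rV[R]_n => _) =
  fun u => \sum_j (\sum_i u 0 i * M i j) * u 0 j); last first.
  by apply/funext => u; rewrite dotE; apply: eq_bigr => j _; rewrite mxE.
apply: (@continuous_sumr 'rV[R]_n n
  (fun j u => (\sum_i u 0 i * M i j) * u 0 j)) => j.
apply: (@continuous_mulr 'rV[R]_n (fun u => \sum_i u 0 i * M i j)
  (fun u => u 0 j)); last exact: coord_continuous.
apply: (@continuous_sumr 'rV[R]_n n (fun i u => u 0 i * M i j)) => i.
apply: (@continuous_mulr 'rV[R]_n (fun u => u 0 i) (fun=> M i j)).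
  exact: coord_continuous.
exact: cst_continuous.
Qed.

(** The variational principle, relative to an invariant subspace that is cut out
    by a matrix [C]: a maximiser of the quadratic form on the unit sphere of the
    subspace is an eigenvector. *)
Lemma exists_large_eigenvalue n p (C : 'M[R]_(n, p)) (M : 'M[R]_n) b
    (u : 'rV_n) :
    M^T = M -> (forall v : 'rV_n, v *m C = 0 -> v *m M *m C = 0) ->
    u *m C = 0 -> b * dot u u < dot (u *m M) u ->
  exists b' (v : 'rV_n), [/\ b < b', v *m C = 0, v != 0 & v *m M = b' *: v].
Proof.
move=> sM MC uC ub.
have u0 : u != 0.
  by apply/eqP => u0; move: ub; rewrite u0 mul0mx dot0l mulr0 ltxx.
pose K := [set v : 'rV[R]_n | v *m C = 0 /\ dot v v = 1].
have normK v : v != 0 -> v *m C = 0 -> K ((Num.sqrt (dot v v))^-1 *: v).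
  move=> v0 vC; split; first by rewrite -scalemxAl vC scaler0.
  have d0 : 0 < dot v v by rewrite dot_gt0.
  rewrite dotZl dotZr mulrA -invfM -expr2 sqr_sqrtr ?ltW //.
  by rewrite mulVf // gt_eqF.
have clK : closed K.
  have -> : K = (fun v => dot (v *m (C *m C^T)) v) @^-1` [set 0] `&`
                (fun v => dot (v *m 1%:M) v) @^-1` [set 1].
    apply/seteqP; split => v /=; rewrite mulmx1 mulmxA.
      by case=> vC ->; rewrite vC mul0mx dot0l.
    rewrite dot_adj trmxK => -[/eqP vC vv].
    by move: vC; rewrite dot_eq0 => /eqP.
  apply: closedI; apply: preimage_closed;
    by [exact: closed_eq|move=> ? _; exact: continuous_quadratic].
have bdK : bounded_set K.
  exists 1; split => // x x1 v [_ vv]; apply: le_trans (ltW x1).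
  rewrite [`|v|]mx_normrE; apply/bigmax_leP; split => // -[i j] _ /=.
  rewrite ord1 -(@expr_le1 _ 2) // -normrX ger0_norm ?sqr_ge0 //.
  rewrite -vv dotE (bigD1 j) //= -expr2 lerDl.
  by apply: sumr_ge0 => k _; rewrite -expr2 sqr_ge0.
have [] := @EVT_max_rV _ _ (fun v => dot (v *m M) v) K.
- by exists ((Num.sqrt (dot u u))^-1 *: u); exact: normK.
- exact: bounded_closed_compact.
- by apply: continuous_subspaceT; exact: continuous_quadratic.
move=> v /set_mem[vC vv] vmax.
pose m := dot (v *m M) v.
have maxm w : w *m C = 0 -> dot (w *m M) w <= m * dot w w.
  move=> wC; have [->|w0] := eqVneq w 0; first by rewrite mul0mx !dot0l mulr0.
  have := vmax _ (mem_set (normK _ w0 wC)).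
  have d0 : 0 < dot w w by rewrite dot_gt0.
  rewrite -scalemxAl dotZl dotZr mulrA -invfM -expr2 sqr_sqrtr ?(ltW d0) //.
  by rewrite ler_pdivrMl // mulrC.
have bm : b < m.
  rewrite -(@ltr_pM2r _ (dot u u)) ?dot_gt0 //.
  exact: lt_le_trans ub (maxm _ uC).
exists m, v; split => //.
  by rewrite -dot_gt0 vv ltr01.
(* m - M is nonnegative on the subspace and vanishes at v, hence kills v *)
pose N := m%:M - M; pose w := v *m N.
have wE x : x *m N = m *: x - x *m M by rewrite mulmxBr mul_mx_scalar.
have wC : w *m C = 0 by rewrite /w wE mulmxBl -scalemxAl vC MC // scaler0 subr0.
have /eqP : dot w w = 0.
  apply: (psd_isotropic (C := C)) => //.
  - by rewrite /N raddfB /= tr_scalar_mx sM.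
  - by move=> x xC; rewrite wE dotDl dotNl dotZl subr_ge0; exact: maxm.
  - by rewrite wE dotDl dotNl dotZl vv mulr1 subrr.
by rewrite dot_eq0 /w wE subr_eq0 => /eqP.
Qed.

End Extremal.
(** * Orthogonal projections *)

Section GramSchmidt.
Context {R : realType} {n : nat}.
Implicit Types (X : seq 'rV[R]_n) (u x : 'rV[R]_n).

(** The orthogonal projection onto the span of a list, built by Gram-Schmidt.
    A vector that depends on the following ones contributes nothing, because
    its orthogonal part [w] vanishes. *)
Fixpoint span_proj X : 'M[R]_n :=
  if X is x :: X' then
    let w := x - x *m span_proj X' in
    span_proj X' + (dot w w)^-1 *: (w^T *m w)
  else 0.

Lemma mulmx_rank1 p (v : 'rV[R]_n) (u : 'rV[R]_n) (w : 'rV[R]_p) :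
  u *m (v^T *m w) = dot u v *: w.
Proof. by rewrite mulmxA [u *m v^T]mx11_scalar mul_scalar_mx. Qed.

Lemma span_proj_sym X : (span_proj X)^T = span_proj X.
Proof.
elim: X => [|x X IH] /=; first by rewrite trmx0.
by rewrite linearD /= linearZ /= trmx_mul trmxK IH.
Qed.

Lemma span_proj_idem X : span_proj X *m span_proj X = span_proj X.
Proof.
elim: X => [|x X IH] /=; first by rewrite mul0mx.
set P := span_proj X; set w := x - x *m P.
have wP : w *m P = 0 by rewrite /w mulmxBl -mulmxA IH subrr.
have Pw : P *m w^T = 0.
  by rewrite -[P]trmxK -trmx_mul span_proj_sym wP trmx0.
have PA : P *m (w^T *m w) = 0 by rewrite mulmxA Pw mul0mx.
have AP : w^T *m w *m P = 0 by rewrite -mulmxA wP mulmx0.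
have AA : w^T *m w *m (w^T *m w) = dot w w *: (w^T *m w).
  by rewrite -mulmxA mulmx_rank1 -scalemxAr.
clearbody w; rewrite mulmxDl !mulmxDr IH -!scalemxAr -!scalemxAl PA AP AA.
rewrite !scaler0 addr0 add0r; congr (_ + _); rewrite !scalerA.
have [->|w0] := eqVneq (dot w w) 0; first by rewrite invr0 !mul0r.
by rewrite mulfVK.
Qed.

Lemma span_proj_orth X u :
  (forall x, x \in X -> dot u x = 0) -> u *m span_proj X = 0.
Proof.
elim: X => [|x X IH] uX /=; first by rewrite mulmx0.
have uX' : u *m span_proj X = 0.
  by apply: IH => y yX; apply: uX; rewrite inE yX orbT.
set w := x - _; have uw : dot u w = 0.
  rewrite dotDr dotNr [dot u (x *m _)]dotC dot_adj span_proj_sym uX' dot0r.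
  by rewrite uX ?mem_head // subrr.
clearbody w; rewrite mulmxDr uX' add0r -scalemxAr mulmx_rank1 uw.
by rewrite scale0r scaler0.
Qed.

Lemma span_proj_id X x : x \in X -> x *m span_proj X = x.
Proof.
elim: X => [//|y X IH]; rewrite inE /=.
set P := span_proj X; set w := y - y *m P.
have wP : w *m P = 0 by rewrite /w mulmxBl -mulmxA span_proj_idem subrr.
have yw : dot y w = dot w w.
  by rewrite {2}/w dotDl dotNl dot_adj span_proj_sym wP dot0r subr0.
have yE : y = y *m P + w by rewrite addrC subrK.
clearbody w; have [-> _|_ /= xX] := eqVneq x y.
  rewrite mulmxDr -scalemxAr mulmx_rank1 scalerA yw.
  have [/eqP|w0] := eqVneq (dot w w) 0.
    by rewrite dot_eq0 => /eqP w0; rewrite w0 scaler0 [RHS]yE w0.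
  by rewrite mulVf // scale1r -yE.
rewrite mulmxDr -scalemxAr mulmx_rank1 IH //.
have -> : dot x w = 0 by rewrite -(IH xX) dot_adj span_proj_sym wP dot0r.
by rewrite scale0r scaler0 addr0.
Qed.

Lemma span_proj_tr X : \tr (span_proj X) <= (size X)%:R.
Proof.
elim: X => [|x X IH] /=; first by rewrite raddf0.
set w := x - _; rewrite mxtraceD mxtraceZ mxtrace_mulC.
rewrite -natr1 lerD // trace_mx11 -/(dot w w).
have [->|w0] := eqVneq (dot w w) 0; first by rewrite invr0 mul0r ler01.
by rewrite mulVf.
Qed.

Lemma span_proj_sub X (Q : 'M[R]_n) :
  (forall x, x \in X -> x *m Q = x) -> span_proj X *m Q = span_proj X.
Proof.
elim: X => [|x X IH] XQ /=; first by rewrite mul0mx.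
have PQ : span_proj X *m Q = span_proj X.
  by apply: IH => y yX; apply: XQ; rewrite inE yX orbT.
have wQ : (x - x *m span_proj X) *m Q = x - x *m span_proj X.
  by rewrite mulmxBl XQ ?mem_head // -mulmxA PQ.
move: (x - _) wQ => w wQ.
by rewrite mulmxDl PQ -scalemxAl -mulmxA wQ.
Qed.

(** Invariance of the span under [L^T] is invariance of its orthogonal
    complement under [L]. *)
Lemma span_proj_comm X (L : 'M[R]_n) :
    (forall x, x \in X -> x *m L *m span_proj X = x *m L) ->
    (forall x, x \in X -> x *m L^T *m span_proj X = x *m L^T) ->
  L *m span_proj X = span_proj X *m L.
Proof.
have key M : (forall x, x \in X -> x *m M *m span_proj X = x *m M) ->
    span_proj X *m M *m span_proj X = span_proj X *m M.
  move=> MX; apply/eqP; rewrite eq_sym -subr_eq0 -{1}[_ *m M]mulmx1 -mulmxBr.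
  rewrite -[X in X == _]trmxK trmx_eq0 trmx_mul trmx_mul span_proj_sym.
  rewrite linearB /= trmx1 span_proj_sym mulmxA; apply/eqP/row_matrixP => i.
  rewrite row_mul row0; apply: span_proj_orth => x xX.
  rewrite rowE mulmxA 2!dot_adj trmxK linearB /= trmx1 span_proj_sym.
  by rewrite mulmxBr mulmx1 MX // subrr dot0r.
move=> L1 L2; rewrite -(key _ L1) -[LHS]trmxK trmx_mul span_proj_sym.
by rewrite -(key _ L2) !trmx_mul trmxK span_proj_sym mulmxA.
Qed.

End GramSchmidt.
(** * The regular representation *)

Section Regular.
Context {R : realType} {gT : finGroupType}.

(** The right regular representation: the point mass at [s], a row vector, goes
    to the point mass at [s * a]. *)
Definition rho (a : gT) : 'M[R]_#|gT| :=
  \matrix_(i, j) (enum_val j == enum_val i * a)%g%:R.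

Lemma rho1 : rho 1%g = 1%:M.
Proof.
apply/matrixP => i j; rewrite !mxE mulg1 eq_sym.
by rewrite (inj_eq enum_val_inj).
Qed.

Lemma rhoM a b : rho (a * b)%g = rho a *m rho b.
Proof.
apply/matrixP => i j; rewrite !mxE (bigD1 (enum_rank (enum_val i * a)%g)) //=.
rewrite !mxE !enum_rankK eqxx mul1r mulgA big1 ?addr0 // => k ki.
rewrite !mxE (_ : (_ == _) = false) ?mul0r //.
by apply/negP => /eqP E; move/eqP: ki; apply; rewrite -E enum_valK.
Qed.

Lemma rho_tr a : (rho a)^T = rho a^-1%g.
Proof.
apply/matrixP => i j; rewrite !mxE eq_sym; congr ((_ : bool)%:R).
by apply/eqP/eqP => [<-|->]; rewrite ?mulgK ?mulgKV.
Qed.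

Lemma rhoKV a : rho a *m rho a^-1%g = 1%:M.
Proof. by rewrite -rhoM mulgV rho1. Qed.

Lemma rhoJ a b : rho (b ^ a)%g = rho a^-1%g *m rho b *m rho a.
Proof. by rewrite conjgE !rhoM mulmxA. Qed.

Lemma dot_rho a (f : 'rV[R]_#|gT|) :
  dot (f *m rho a) (f *m rho a) = dot f f.
Proof. by rewrite dot_adj rho_tr -mulmxA rhoKV mulmx1. Qed.

Lemma rho_le a (f : 'rV[R]_#|gT|) : (dot (f *m rho a) f <= dot f f).
Proof.
have := dot_ge0 (f *m rho a - f).
rewrite !(dotDl, dotDr, dotNl, dotNr) dot_rho [dot f (_ *m _)]dotC; lra.
Qed.

Lemma rho_ge a (f : 'rV[R]_#|gT|) : (- dot f f <= dot (f *m rho a) f).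
Proof.
have := dot_ge0 (f *m rho a + f).
rewrite !(dotDl, dotDr) dot_rho [dot f (_ *m _)]dotC; lra.
Qed.

End Regular.

(** * Sums of transpositions *)

Section Transpositions.
Context {R : realType} {n : nat}.
Notation rho := (@rho R 'S_n.+1).
Implicit Types (X A : {set 'I_n.+1}) (v w : 'I_n.+1).

(** For [X] an initial segment and [v] its last element this is a
    Jucys-Murphy element. *)
Definition star X v : 'M[R]_#|'S_n.+1| := \sum_(w in X :\ v) rho (tperm v w).

Definition transp X : 'M[R]_#|'S_n.+1| := 2^-1 *: \sum_(v in X) star X v.

Lemma rho_tperm_sym v w : (rho (tperm v w))^T = rho (tperm v w).
Proof. by rewrite rho_tr tpermV. Qed.

Lemma rho_tperm2 v w : rho (tperm v w) *m rho (tperm v w) = 1%:M.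
Proof. by rewrite -rhoM tperm2 rho1. Qed.

Lemma star_sym X v : (star X v)^T = star X v.
Proof.
by rewrite raddf_sum; apply: eq_bigr => w _; exact: rho_tperm_sym.
Qed.

Lemma transp_sym X : (transp X)^T = transp X.
Proof.
rewrite linearZ /= raddf_sum; congr (_ *: _).
by apply: eq_bigr => v _; exact: star_sym.
Qed.

Lemma imset_permD1 (a : 'S_n.+1) X v : a @: (X :\ v) = a @: X :\ a v.
Proof.
apply/setP => x; rewrite -(permKV a x) !inE !(mem_imset _ _ perm_inj) !inE.
by rewrite (inj_eq perm_inj).
Qed.

Lemma star_conj (a : 'S_n.+1) X v :
  star X v *m rho a = rho a *m star (a @: X) (a v).
Proof.
rewrite mulmx_suml mulmx_sumr -imset_permD1.
rewrite big_imset /=; last by move=> x y _ _ /perm_inj.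
apply: eq_bigr => w _; rewrite -!rhoM; congr rho.
by rewrite -tpermJ conjgE mulgA mulgA mulgV mul1g.
Qed.

Lemma transp_conj (a : 'S_n.+1) X :
  transp X *m rho a = rho a *m transp (a @: X).
Proof.
rewrite -scalemxAl -scalemxAr; congr (_ *: _).
rewrite mulmx_suml mulmx_sumr big_imset /=; last by move=> x y _ _ /perm_inj.
by apply: eq_bigr => v _; exact: star_conj.
Qed.

Lemma transp_comm (a : 'S_n.+1) X :
  a @: X = X -> transp X *m rho a = rho a *m transp X.
Proof. by move=> aX; rewrite transp_conj aX. Qed.

Lemma transpT_comm (a : 'S_n.+1) :
  transp setT *m rho a = rho a *m transp setT.
Proof.
apply: transp_comm; apply/setP => x; rewrite !inE.
by rewrite -(permKV a x) imset_f.
Qed.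

Lemma transp_add X v : v \notin X ->
  transp (v |: X) = transp X + star (v |: X) v.
Proof.
move=> vX; rewrite /transp big_setU1 //=.
have -> : \sum_(w in X) star (v |: X) w =
          \sum_(w in X) star X w + star (v |: X) v.
  rewrite {3}/star setU1K // -big_split /=; apply: eq_bigr => w wX.
  rewrite {1}/star (_ : _ :\ w = v |: (X :\ w)); last first.
    apply/setP => x; rewrite !inE; case: eqVneq => //= ->; rewrite orbF.
    by apply/esym/negbTE/eqP => wv; move: vX; rewrite -wv wX.
  by rewrite big_setU1 ?inE ?(negbTE vX) ?andbF //= addrC tpermC.
rewrite addrCA -mulr2n scalerDr -scaler_nat scalerA mulVf ?pnatr_eq0 //.
by rewrite scale1r.
Qed.

Lemma star_le X v (f : 'rV[R]__) : v \in X ->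
  dot (f *m star X v) f <= (#|X|%:R - 1) * dot f f.
Proof.
move=> vX; rewrite mulmx_sumr dot_suml (cardsD1 v X) vX add1n -natr1 addrK.
apply: le_trans (ler_sum _ (fun w _ => rho_le (tperm v w) f)) _.
by rewrite sumr_const mulr_natl.
Qed.

Lemma star_ge X v (f : 'rV[R]__) : v \in X ->
  - ((#|X|%:R - 1) * dot f f) <= dot (f *m star X v) f.
Proof.
move=> vX; rewrite mulmx_sumr dot_suml (cardsD1 v X) vX add1n -natr1 addrK.
apply: le_trans (ler_sum _ (fun w _ => rho_ge (tperm v w) f)).
by rewrite sumr_const mulr_natl mulNrn.
Qed.

Lemma dot_transp X (f : 'rV[R]__) :
  dot (f *m transp X) f = 2^-1 * \sum_(v in X) dot (f *m star X v) f.
Proof. by rewrite -scalemxAr dotZl mulmx_sumr dot_suml. Qed.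

Lemma transp_ge X (f : 'rV[R]__) :
  - (#|X|%:R * (#|X|%:R - 1) / 2 * dot f f) <= dot (f *m transp X) f.
Proof.
rewrite dot_transp.
have : \sum_(v in X) - ((#|X|%:R - 1) * dot f f)
       <= \sum_(v in X) dot (f *m star X v) f.
  by apply: ler_sum => v vX; exact: star_ge.
by rewrite sumr_const -mulr_natl; lra.
Qed.

Lemma transp_le X (f : 'rV[R]__) :
  dot (f *m transp X) f <= #|X|%:R * (#|X|%:R - 1) / 2 * dot f f.
Proof.
rewrite dot_transp.
have : \sum_(v in X) dot (f *m star X v) f
       <= \sum_(v in X) ((#|X|%:R - 1) * dot f f).
  by apply: ler_sum => v vX; exact: star_le.
by rewrite sumr_const -mulr_natl; lra.
Qed.

End Transpositions.
(** * Comparison with random transpositions *)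

Section Comparison.
Context {R : realType} {n : nat}.
Notation rho := (@rho R 'S_n.+1).
Notation M := 'M[R]_#|'S_n.+1|.

Definition init m : {set 'I_n.+1} := [set i : 'I_n.+1 | (i <= m)%N].

Definition adj m : 'S_n.+1 := tperm (inord m) (inord m.+1).

(** The sum over [i <= m] of the cycles moving position [i] to position [m],
    in the recursive form that makes the commutation relation below a short
    computation. *)
Fixpoint to_last m : M :=
  if m is m'.+1 then 1%:M + to_last m' *m rho (adj m') else 1%:M.

Lemma inord_neq i j : (i <= n)%N -> (j <= n)%N -> i != j ->
  (inord i : 'I_n.+1) != inord j.
Proof.
move=> lein lejn; apply: contraNN => /eqP/(congr1 (@nat_of_ord _)).
by rewrite !inordK // => ->.
Qed.

Lemma adj_braid m : (m.+1 < n)%N ->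
  rho (adj m) *m rho (adj m.+1) *m rho (adj m) =
  rho (adj m.+1) *m rho (adj m) *m rho (adj m.+1).
Proof.
move=> mn; rewrite -!rhoM; congr rho.
have h1 : (inord m : 'I_n.+1) != inord m.+1 by apply: inord_neq; lia.
have h2 : (inord m.+1 : 'I_n.+1) != inord m.+2 by apply: inord_neq; lia.
have h3 : (inord m : 'I_n.+1) != inord m.+2 by apply: inord_neq; lia.
have : (adj m.+1 ^ adj m = adj m ^ adj m.+1)%g.
  by rewrite /adj !tpermJ tpermR tpermL !tpermD // eq_sym.
by rewrite !conjgE !tpermV !mulgA.
Qed.

Lemma adj_far i k : (i.+1 < k)%N -> (k < n)%N ->
  rho (adj i) *m rho (adj k) = rho (adj k) *m rho (adj i).
Proof.
move=> ik kn; rewrite -!rhoM; congr rho.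
have h1 : (inord i : 'I_n.+1) != inord k by apply: inord_neq; lia.
have h2 : (inord i.+1 : 'I_n.+1) != inord k by apply: inord_neq; lia.
have h3 : (inord i : 'I_n.+1) != inord k.+1 by apply: inord_neq; lia.
have h4 : (inord i.+1 : 'I_n.+1) != inord k.+1 by apply: inord_neq; lia.
have E : (adj k ^ adj i = adj k)%g by rewrite /adj tpermJ !tpermD.
by rewrite -[in LHS]E conjgE !mulgA mulgV mul1g.
Qed.

Lemma to_last_comm m k : (m < k)%N -> (k < n)%N ->
  to_last m *m rho (adj k) = rho (adj k) *m to_last m.
Proof.
elim: m => [|m IH] mk kn /=; first by rewrite mul1mx mulmx1.
rewrite mulmxDl mulmxDr mul1mx mulmx1 -mulmxA adj_far // mulmxA IH //; last lia.
by rewrite mulmxA.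
Qed.

Lemma star_init_rec m : (m < n)%N ->
  star (init m.+1) (inord m.+1) =
  rho (adj m) *m star (init m) (inord m) *m rho (adj m) + rho (adj m) :> M.
Proof.
move=> mn; have ne : (inord m : 'I_n.+1) != inord m.+1 by apply: inord_neq; lia.
rewrite -mulmxA star_conj mulmxA rho_tperm2 mul1mx tpermL.
have memE x : (x \in adj m @: init m) = (adj m x <= m)%N.
  rewrite -{1}[x](tpermK (inord m) (inord m.+1)) (mem_imset _ _ perm_inj).
  by rewrite inE.
have E : init m.+1 :\ inord m.+1 =
         inord m |: (adj m @: init m :\ inord m.+1) :> {set 'I_n.+1}.
  apply/setP => x; rewrite !(in_setD1, in_setU1) memE inE.
  rewrite -!(inj_eq val_inj) /= !inordK; try lia.
  by case: tpermP => [->|->|]; rewrite ?inordK; lia.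
rewrite /star E big_setU1 /=; last first.
  by rewrite in_setD1 memE tpermL inordK ?ltnn ?andbF; lia.
by rewrite addrC tpermC.
Qed.

Let commutation_step (s s' b J : M) (k : R) :
    s^T = s -> s'^T = s' -> s *m s = 1%:M ->
    s *m s' *m s = s' *m s *m s' -> b *m s = s *m b ->
    (1%:M + b *m s')^T *m (1%:M + b *m s') = k%:M + J + b *m s' *m b^T ->
  (1%:M + (1%:M + b *m s') *m s)^T *m (1%:M + (1%:M + b *m s') *m s) =
  (k + 1)%:M + (s *m J *m s + s)
  + (1%:M + b *m s') *m s *m (1%:M + b *m s')^T.
Proof.
move=> sT s'T ss braid bs; set B := 1%:M + b *m s' => BB.
have bTs : b^T *m s = s *m b^T by rewrite -{1}sT -trmx_mul -bs trmx_mul sT.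
have BT : B^T = 1%:M + s' *m b^T.
  by rewrite linearD /= trmx1 trmx_mul s'T.
have E1 : s *m (b *m s' *m b^T) *m s = b *m (s' *m (s *m (s' *m b^T))).
  rewrite !mulmxA -bs -!mulmxA bTs !mulmxA.
  by rewrite -(mulmxA b s) -(mulmxA b _ s) braid !mulmxA.
have -> : (1%:M + B *m s)^T = 1%:M + s *m B^T.
  by rewrite linearD /= trmx1 trmx_mul sT.
have expand (C D : M) : (1%:M + s *m C) *m (1%:M + D *m s) =
    1%:M + D *m s + s *m C + s *m (C *m D) *m s.
  by rewrite mulmxDl !mulmxDr !mul1mx mulmx1 !mulmxA addrA.
rewrite expand BB mulmxDr mulmxDl E1 mulmxDr mulmxDl mul_mx_scalar.
rewrite -scalemxAl ss.
rewrite BT /B !(mulmxDl, mulmxDr) !(mul1mx, mulmx1) -!mulmxA.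
rewrite -[(k + 1)%:M]scalemx1 scalerDl scale1r.
move: (s *m (J *m s)) (b *m (s' *m s)) (s *m (s' *m b^T))
  (b *m (s' *m (s *m (s' *m b^T)))) => x1 x2 x3 x4.
by apply/matrixP => i j; rewrite !mxE; ring.
Qed.

(** Inserting the last card and then pulling another position out to the end:
    besides the identity and a Jucys-Murphy element, this is the shuffle of one
    card fewer, with a transposition in the middle. *)
Lemma to_last_commutation m : (m < n)%N ->
  (to_last m.+1)^T *m to_last m.+1 =
  (m.+2)%:R%:M + star (init m.+1) (inord m.+1)
  + to_last m *m rho (adj m) *m (to_last m)^T.
Proof.
elim: m => [|m IH] mn; rewrite star_init_rec //.
  have -> : star (init 0) (inord 0) = 0 :> M.
    rewrite /star big1 // => w; rewrite !inE -!(inj_eq val_inj) /= inordK //.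
    by case: (val w).
  have -> : (to_last 1)^T = to_last 1.
    by rewrite /= mul1mx linearD /= trmx1 rho_tperm_sym.
  rewrite mulmx0 mul0mx add0r /= trmx1 mul1mx mulmx1 mulmxDl !mulmxDr.
  rewrite !(mul1mx, mulmx1) rho_tperm2.
  by apply/matrixP => i j; rewrite !mxE -natr1; ring.
rewrite -[m.+3%:R]natr1; apply: commutation_step.
- exact: rho_tperm_sym.
- exact: rho_tperm_sym.
- exact: rho_tperm2.
- exact/esym/adj_braid.
- exact: to_last_comm.
- exact/IH/ltnW.
Qed.

End Comparison.
Section Majorant.
Context {R : realType} {n : nat}.
Notation rho := (@rho R 'S_n.+1).
Notation M := 'M[R]_#|'S_n.+1|.
Notation init := (@init n).
Notation to_last := (@to_last R n).

(** The constant is the sum of those in the commutation relation, so that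
    [majorant m.+1] exceeds [majorant m] by exactly the first two terms of that
    relation. *)
Definition majorant m : M := ((m.+1 * m.+2)%:R / 2)%:M + transp (init m).

Lemma init0 : init 0 = [set inord 0].
Proof.
apply/setP => x; rewrite !inE -(inj_eq val_inj) /= inordK //.
by rewrite leqn0.
Qed.

Lemma initS m : (m < n)%N -> init m.+1 = inord m.+1 |: init m.
Proof.
move=> mn; apply/setP => x.
by rewrite !inE -(inj_eq val_inj) /= inordK // leq_eqVlt.
Qed.

Lemma inord_notin_init m : (m < n)%N -> inord m.+1 \notin init m.
Proof. by move=> mn; rewrite inE inordK // ltnn. Qed.

Lemma card_init m : (m <= n)%N -> #|init m| = m.+1.
Proof.
elim: m => [|m IH] mn; first by rewrite init0 cards1.
by rewrite initS // cardsU1 inord_notin_init // IH // ltnW.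
Qed.

Lemma init_max : init n = [set: 'I_n.+1].
Proof. by apply/setP => x; rewrite !inE -ltnS ltn_ord. Qed.

Lemma majorantS m : (m < n)%N ->
  majorant m.+1 = m.+2%:R%:M + star (init m.+1) (inord m.+1) + majorant m.
Proof.
move=> mn; rewrite /majorant initS // transp_add ?inord_notin_init // -initS //.
have -> : (m.+2 * m.+3)%:R / 2 = m.+2%:R + (m.+1 * m.+2)%:R / 2 :> R.
  by rewrite !natrM -!natr1; field.
by rewrite raddfD /= [transp _ + _]addrC addrACA.
Qed.

Lemma majorant_ge m (f : 'rV[R]__) : (m <= n)%N ->
  m.+1%:R * dot f f <= dot (f *m majorant m) f.
Proof.
move=> mn; rewrite mulmxDr mul_mx_scalar dotDl dotZl.
have := transp_ge (init m) f.
rewrite card_init // natrM -[m.+2%:R]natr1 -[m.+1%:R]natr1.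
move: (dot (f *m _) f) (dot f f) m%:R => t d k; lra.
Qed.

Lemma majorant_comm m : (m <= n)%N ->
  majorant m *m to_last m = to_last m *m majorant m.
Proof.
move=> mn; rewrite mulmxDl mulmxDr mul_scalar_mx mul_mx_scalar; congr (_ + _).
suff h k : (k <= m)%N ->
    transp (init m) *m to_last k = to_last k *m transp (init m) by exact: h.
elim: k => [|k IH] km /=; first by rewrite mul1mx mulmx1.
rewrite mulmxDr mulmxDl mulmx1 mul1mx mulmxA IH 1?ltnW // -!mulmxA.
rewrite transp_comm //; apply/setP => x.
rewrite -[x](tpermK (inord k) (inord k.+1)) (mem_imset _ _ perm_inj) tpermK.
rewrite !inE.
by case: tpermP => // ->; rewrite !inordK; lia.
Qed.

(** Induction and the commutation relation bound [B^T B] by the majorant [H].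
    Since [H] commutes with [B], it follows that [X = B B^T] satisfies
    [X^2 <= X H], and testing this on an eigenvector of [X - H] for a positive
    eigenvalue is contradictory, as [H] is positive. *)
Lemma to_last_le m (f : 'rV[R]__) : (m <= n)%N ->
  dot (f *m (to_last m *m (to_last m)^T)) f <= dot (f *m majorant m) f.
Proof.
elim: m f => [|m IH] f mn.
  rewrite /= trmx1 mulmx1 mulmx1.
  by have := @majorant_ge 0 f mn; rewrite mul1r.
set H := majorant m.+1; set B := to_last m.+1.
have Hsym : H^T = H by rewrite /H linearD /= tr_scalar_mx transp_sym.
have YH (g : 'rV[R]__) : dot (g *m (B^T *m B)) g <= dot (g *m H) g.
  rewrite to_last_commutation // /H majorantS //.
  rewrite mulmxDr dotDl [in leRHS]mulmxDr [in leRHS]dotDl lerD2l.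
  apply: le_trans (IH _ (ltnW mn)); rewrite !mulmxA !dot_adjT.
  exact: rho_le.
rewrite leNgt; apply/negP => fH.
have [||||b [v [b0 _ v0 vE]]] := @exists_large_eigenvalue R _ 0
  (0 : 'M_(_, 0)) (B *m B^T - H) 0 f.
- by rewrite linearB /= trmx_mul trmxK Hsym.
- by move=> v _; rewrite mulmx0.
- by rewrite mulmx0.
- by rewrite mul0r mulmxBr dotDl dotNl subr_gt0.
have vX : v *m (B *m B^T) = v *m H + b *: v.
  by rewrite -vE mulmxBr addrC subrK.
have XX : dot (v *m (B *m B^T)) (v *m (B *m B^T)) <=
          dot (v *m H) (v *m (B *m B^T)).
  have := YH (v *m B); rewrite -!mulmxA -(majorant_comm mn) -/B -/H.
  rewrite [leLHS]dotC [leRHS]dotC.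
  have e (x : 'rV[R]__) : dot (v *m B) (x *m B) = dot (v *m (B *m B^T)) x.
    by rewrite [in RHS]mulmxA dot_adjT.
  by rewrite !mulmxA !e -!mulmxA dotC [leRHS]dotC.
have := majorant_ge v mn; rewrite -/H => Hv.
have vv : 0 < dot v v by rewrite dot_gt0.
have : b * dot v (v *m (B *m B^T)) <= 0.
  by move: XX; rewrite {1}vX dotDl dotZl gerDl.
rewrite pmulr_rle0 // vX dotDr dotZr [dot v (_ *m _)]dotC leNgt => /negP; apply.
apply: ltr_wpDl; last exact: mulr_gt0.
by apply: le_trans Hv; rewrite mulr_ge0 // ltW.
Qed.

End Majorant.
(** * The transition matrix *)

Section Transition.
Context {R : realType} {n : nat}.
Notation rho := (@rho R 'S_n.+1).
Notation M := 'M[R]_#|'S_n.+1|.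
Local Notation P := (@random_to_random R n.+1).

Definition r2r_mx : M := \matrix_(i, j) P (enum_val i) (enum_val j).

Lemma lift_perm_max_val (i x : 'I_n.+1) :
  lift_perm i ord_max 1%g x = (if x == i then n else x - (i < x)%N)%N :> nat.
Proof.
case: (unliftP i x) => [k|] ->; last by rewrite lift_perm_id eqxx.
rewrite lift_perm_lift perm1 eq_sym (negbTE (neq_lift _ _)).
rewrite lift_max /= /bump; case: (leqP i k) => ik.
  by rewrite add1n ltnS ik subn1.
by rewrite add0n ltnNge (ltnW ik) subn0.
Qed.

Lemma lift_perm_max_rec m : (m < n)%N ->
  lift_perm (inord m) ord_max 1%g =
  (@adj n m * lift_perm (inord m.+1) ord_max 1)%g.
Proof.
move=> mn; apply/permP => x; apply: val_inj; rewrite /= permM.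
rewrite !lift_perm_max_val -!(inj_eq val_inj) /= !inordK; try lia.
have := ltn_ord x; case: tpermP => [->|->|/eqP xm /eqP xm1] xn.
- by rewrite !inordK ?eqxx //; lia.
- rewrite !inordK; try lia.
  rewrite (gtn_eqF (ltnSn m)) (ltn_eqF (ltnSn m)) ltnSn ltnNge leqnSn /=.
  by rewrite subn1 subn0.
move: xm xm1; rewrite -!(inj_eq val_inj) /= !inordK; try lia.
move=> xm xm1; rewrite (negbTE xm) (negbTE xm1).
by congr (_ - nat_of_bool _)%N; apply/idP/idP; lia.
Qed.

Lemma to_lastE m : (m <= n)%N ->
  to_last m = \sum_(0 <= i < m.+1) rho (\prod_(i <= j < m) @adj n j)%g :> M.
Proof.
elim: m => [|m IH] mn /=; first by rewrite big_nat1 big_geq // rho1.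
rewrite big_nat_recr //= [\big[_/_]_(m.+1 <= _ < _) _]big_geq // rho1 addrC.
rewrite IH 1?ltnW // mulmx_suml; congr (_ + _).
rewrite !big_nat; apply: eq_bigr => i /andP[_ im].
by rewrite big_nat_recr //= rhoM.
Qed.

Lemma to_last_max : to_last n = \sum_i rho (lift_perm i ord_max 1%g) :> M.
Proof.
rewrite to_lastE // big_mkord; apply: eq_bigr => i _; congr rho.
have [d E] : exists d, (n - i)%N = d by exists (n - i)%N.
have le_in : (i <= n)%N by rewrite -ltnS.
rewrite -[in RHS](inord_val i).
elim: d (val i) le_in E => [|d IH] k kn E.
  have -> : k = n by lia.
  rewrite big_geq // (_ : inord n = ord_max) ?lift_perm1 //.
  by apply: val_inj; rewrite /= inordK.
rewrite big_ltn ?IH; try lia.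
by rewrite (@lift_perm_max_rec k) //; lia.
Qed.

(** Removing a card and reinserting it amounts to moving it to the end of the
    deck and then from the end to its new place. *)
Lemma r2r_factor : (n.+1 ^ 2)%:R *: r2r_mx = to_last n *m (to_last n)^T.
Proof.
apply/matrixP => x y; rewrite 2![in LHS]mxE mulrC divfK; last first.
  by rewrite pnatr_eq0 -lt0n expn_gt0.
set s := enum_val x; set u := enum_val y.
transitivity (\sum_i \sum_j (rho (lift_perm i j 1%g) x y)).
  rewrite -sum1_card natr_sum big_mkcond /=.
  transitivity (\sum_c \sum_j (reinsert s c j == u)%:R : R).
    rewrite pair_bigA; apply: eq_bigr => -[c j] _; rewrite inE /=.
    by case: eqP.
  rewrite (reindex_inj (@perm_inj _ s^-1%g)) /=; apply: eq_bigr => i _.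
  apply: eq_bigr => j _; by rewrite /reinsert permKV mxE eq_sym.
rewrite to_last_max raddf_sum /= mulmx_suml summxE; apply: eq_bigr => i _.
rewrite mulmx_sumr summxE; apply: eq_bigr => j _.
by rewrite rho_tr -rhoM lift_permV invg1 lift_permM mulg1.
Qed.

Lemma kernel_powE t x y :
  kernel_pow P t x y = (r2r_mx ^+ t) (enum_rank x) (enum_rank y).
Proof.
elim: t x y => [|t IH] x y /=.
  by rewrite expr0 mxE (inj_eq enum_rank_inj).
rewrite exprS mxE (reindex _ (onW_bij _ (enum_rank_bij _))) /=.
by apply: eq_bigr => z _; rewrite mxE !enum_rankK IH.
Qed.

End Transition.
(** * The degree filtration *)

Section Degree.
Context {R : realType} {n : nat}.
Notation rho := (@rho R 'S_n.+1).
Notation V := 'rV[R]_#|'S_n.+1|.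
Implicit Types (A B C : {set 'I_n.+1}) (f g x : V) (a s : 'S_n.+1) (k : nat).

Definition invar A f := forall a, perm_on A a -> f *m rho a = f.

Lemma mulmx_rho f a s :
  (f *m rho a) 0 (enum_rank (s * a)%g) = f 0 (enum_rank s).
Proof.
rewrite mxE (bigD1 (enum_rank s)) //= mxE !enum_rankK eqxx mulr1 big1 ?addr0 //.
move=> i si; rewrite mxE enum_rankK (inj_eq (mulIg a)) eq_sym.
rewrite (can2_eq enum_valK enum_rankK) (negbTE si) mulr0 //.
Qed.

Lemma invarS A B f : A \subset B -> invar B f -> invar A f.
Proof.
by move=> AB fB a aA; apply: fB; exact: (fintype.subset_trans aA AB).
Qed.

(** Multiply by the transposition that makes some position of [A] fixed, and
    repeat with one position less. *)
Lemma tperm_invar A f :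
  {in A &, forall v w, f *m rho (tperm v w) = f} -> invar A f.
Proof.
have [m] := ubnP #|A|; elim: m A => // m IH A; rewrite ltnS => Am fA a aA.
have [A0|[w wA]] := set_0Vmem A.
  suff -> : a = 1%g by rewrite rho1 mulmx1.
  by apply/permP => y; rewrite perm1 (out_perm aA) // A0 inE.
pose c := (a^-1)%g w.
have cA : c \in A by rewrite -(perm_closed _ aA) permKV.
pose a' := (tperm w c * a)%g.
have a'A : perm_on A a'.
  apply: perm_onM => //; apply: fintype.subset_trans (tperm_on w c) _.
  by apply/fintype.subsetP => y /set2P[] ->.
have a'w : a' w = w by rewrite permM tpermL permKV.
have a'Aw : perm_on (A :\ w) a'.
  apply/fintype.subsetP => y /= ya; rewrite !inE (fintype.subsetP a'A) // andbT.
  by apply: contra ya => /eqP ->; rewrite a'w.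
have -> : a = (tperm w c * a')%g by rewrite mulgA tperm2 mul1g.
rewrite rhoM mulmxA fA // (IH (A :\ w)) //.
- by apply: leq_trans Am; rewrite [X in (_ < X)%N](cardsD1 w) wA.
- by move=> v u; rewrite !inE => /andP[_ vA] /andP[_ uA]; exact: fA.
Qed.

Lemma invar_rho A f a : invar A f -> invar (a @: A) (f *m rho a).
Proof.
move=> fA b bA; rewrite -mulmxA -rhoM.
have -> : (a * b = a * b * a^-1 * a)%g by rewrite mulgKV.
rewrite rhoM mulmxA (fA (a * b * a^-1)%g) //; apply/fintype.subsetP => y.
rewrite inE !permM => /eqP ya.
rewrite -(mem_imset _ _ (@perm_inj _ a)); apply/(fintype.subsetP bA).
by rewrite inE; apply/eqP => h; apply: ya; rewrite h permK.
Qed.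

Lemma exists_superset B k : (#|B| <= k <= n.+1)%N ->
  exists2 C : {set 'I_n.+1}, B \subset C & #|C| = k.
Proof.
case/andP => + kn; move E : (k - #|B|)%N => d.
elim: d B E => [|d IH] B E Bk; first by exists B => //; lia.
have [y yB] : exists y, y \in ~: B.
  apply/set0Pn; rewrite -card_gt0 cardsCs setCK card_ord; lia.
have yB' : #|y |: B| = #|B|.+1 by rewrite cardsU1 -in_setC yB.
have [|| C] := IH (y |: B); rewrite ?yB'; try lia.
by rewrite subUset => /andP[_ BC] Ck; exists C.
Qed.

(** The cards at the positions in [C]; the default value off [C] makes this a
    partial function in the sense of [pffun_on], so that there are [(n + 1)^k]
    candidates when [C] has [k] elements. *)
Definition contents C s : {ffun 'I_n.+1 -> 'I_n.+1} :=
  [ffun p => if p \in C then (s^-1)%g p else ord0].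

(** The functions [cylinder C q] with [C] of size [k] span the functions of
    degree at most [k]. *)
Definition cylinder C q : V := \row_j (contents C (enum_val j) == q)%:R.

Definition cylinders k : seq V :=
  [seq cylinder C q | C <- enum [set C : {set 'I_n.+1} | #|C| == k],
                      q <- enum (pffun_on ord0 C predT)].

Definition deg_proj k := span_proj (cylinders k).


Lemma contents_on C s : contents C s \in pffun_on ord0 C predT.
Proof.
apply/pffun_onP; split=> // ; apply/fintype.subsetP => p; rewrite inE ffunE.
by case: ifP => //; rewrite eqxx.
Qed.

Lemma contents_fiber C s u : contents C s = contents C u ->
  perm_on (~: C) (s^-1 * u)%g.
Proof.
move=> su; apply/fintype.subsetP => p; rewrite inE permM; apply: contraR.
rewrite inE negbK => pC; apply/eqP.
by move/ffunP/(_ p): su; rewrite !ffunE pC => ->; rewrite permKV.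
Qed.

Lemma dot_cylinder C q f :
  dot f (cylinder C q) = \sum_(j | contents C (enum_val j) == q) f 0 j.
Proof.
rewrite dotE [RHS]big_mkcond /=; apply: eq_bigr => j _; rewrite mxE.
by case: eqP; rewrite ?mulr1 ?mulr0.
Qed.

Lemma invar_cylinder C q : invar (~: C) (cylinder C q).
Proof.
move=> a aC; apply/rowP => j; rewrite -(enum_valK j).
rewrite -{1}(mulgKV a (enum_val j)) mulmx_rho !mxE !enum_rankK.
congr ((_ == _)%:R); apply/ffunP => p; rewrite !ffunE.
case: ifP => // pC; rewrite invMg invgK permM.
by rewrite (out_perm aC) // inE pC.
Qed.

Lemma mem_cylinders k f : f \in cylinders k ->
  exists2 C : {set 'I_n.+1}, #|C| = k & invar (~: C) f.
Proof.
case/allpairsPdep => C [q [+ _ ->]]; rewrite mem_enum inE => /eqP Ck.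
by exists C => //; exact: invar_cylinder.
Qed.

Lemma cylinder_mem k C s : #|C| = k ->
  cylinder C (contents C s) \in cylinders k.
Proof.
move=> Ck; apply/allpairsPdep; exists C, (contents C s); split => //.
  by rewrite mem_enum inE Ck.
by rewrite mem_enum contents_on.
Qed.

Lemma size_cylinders k : size (cylinders k) = ('C(n.+1, k) * n.+1 ^ k)%N.
Proof.
rewrite size_allpairs_dep.
rewrite sumnE big_map big_enum /=.
rewrite (eq_bigr (fun=> (n.+1 ^ k)%N)) => [|C]; last first.
  by rewrite inE -cardE card_pffun_on card_ord => /eqP ->.
by rewrite sum_nat_const card_draws card_ord.
Qed.

(** Because [f] is constant on the fibres of [contents C], it is a combination
    of the cylinders on [C]. *)
Lemma dot_invar C f g : invar (~: C) f ->
  (forall s, dot g (cylinder C (contents C s)) = 0) -> dot g f = 0.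
Proof.
move=> fC gC; rewrite dotE.
rewrite (partition_big (fun j => contents C (enum_val j)) xpredT) //=.
apply: big1 => q _.
have [i /eqP iq|no] := pickP (fun j : 'I_#|'S_n.+1| =>
  contents C (enum_val j) == q); last by rewrite big_pred0.
rewrite (eq_bigr (fun j => g 0 j * f 0 i)) => [|j /eqP jq].
  by rewrite -mulr_suml -dot_cylinder -iq gC mul0r.
congr (_ * _); have ij : contents C (enum_val i) = contents C (enum_val j).
  by rewrite iq jq.
have := mulmx_rho f ((enum_val i)^-1 * enum_val j)%g (enum_val i).
by rewrite mulKVg !enum_valK fC //; exact: contents_fiber.
Qed.

Lemma deg_proj_sym k : (deg_proj k)^T = deg_proj k.
Proof. exact: span_proj_sym. Qed.

Lemma deg_proj_idem k : deg_proj k *m deg_proj k = deg_proj k.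
Proof. exact: span_proj_idem. Qed.

(** The description of the degree filtration used from here on: every function
    invariant under the permutations of at least [n + 1 - k] positions has
    degree at most [k]. *)
Lemma deg_proj_invar A k f :
  (#|~: A| <= k <= n.+1)%N -> invar A f -> f *m deg_proj k = f.
Proof.
move=> Ak fA; have [C AC Ck] := exists_superset Ak.
have fC : invar (~: C) f by apply: invarS fA; rewrite -setCS setCK.
pose g := f - f *m deg_proj k.
have gX x : x \in cylinders k -> dot g x = 0.
  move=> xX; rewrite dotDl dotNl dot_adj deg_proj_sym span_proj_id //.
  by rewrite subrr.
have gf : dot g f = 0.
  by apply: (dot_invar fC) => s; apply: gX; exact: cylinder_mem.
have gP : g *m deg_proj k = 0 by exact: span_proj_orth.
have /eqP : dot g g = 0.
  rewrite {2}/g dotDr dotNr gf -[f *m _]mulmx1 sub0r.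
  by rewrite mulmx1 [dot g (_ *m _)]dotC dot_adj deg_proj_sym gP dot0r oppr0.
by rewrite dot_eq0 subr_eq0 => /eqP.
Qed.

Lemma deg_proj_comm a k : (k <= n.+1)%N ->
  rho a *m deg_proj k = deg_proj k *m rho a.
Proof.
move=> kn.
have h b x : x \in cylinders k -> x *m rho b *m deg_proj k = x *m rho b.
  case/mem_cylinders => C Ck /(@invar_rho _ _ b); apply: deg_proj_invar.
  rewrite kn andbT cardsCs setCK card_imset; last exact: perm_inj.
  by rewrite -cardsCs Ck.
apply: span_proj_comm => x; first exact: h.
by rewrite rho_tr; exact: h.
Qed.

Lemma deg_proj_full : deg_proj n.+1 = 1%:M.
Proof.
apply/row_matrixP => i; rewrite rowE row1; apply: (@deg_proj_invar set0).
  by rewrite setC0 cardsT card_ord leqnn.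
move=> a a0; suff -> : a = 1%g by rewrite rho1 mulmx1.
by apply/permP => y; rewrite perm1 (out_perm a0) // inE.
Qed.

Lemma deg_proj_nested j k : (j <= k <= n.+1)%N ->
  deg_proj j *m deg_proj k = deg_proj j.
Proof.
case/andP => jk kn; apply: span_proj_sub => x /mem_cylinders[C Cj].
by apply: deg_proj_invar; rewrite setCK Cj jk.
Qed.

Lemma deg_proj_orth_invar A k f : (#|~: A| <= k <= n.+1)%N ->
  f *m deg_proj k = 0 -> invar A f -> f = 0.
Proof. by move=> Ak f0 /(deg_proj_invar Ak) <-. Qed.

Lemma deg_proj_witness k f : f *m deg_proj k = f -> f != 0 ->
  exists C x, [/\ #|C| = k, invar (~: C) x & dot f x != 0].
Proof.
move=> fP f0.
have [/allP h|] := boolP (all (fun x => dot f x == 0) (cylinders k)).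
  have : f *m deg_proj k = 0 by apply: span_proj_orth => x /h/eqP.
  by rewrite fP => f00; rewrite f00 eqxx in f0.
case/allPn => x /mem_cylinders[C Ck xC] fx.
by exists C, x.
Qed.

Lemma deg_proj_tr k : \tr (deg_proj k) <= ('C(n.+1, k) * n.+1 ^ k)%:R.
Proof. by rewrite -size_cylinders; exact: span_proj_tr. Qed.

End Degree.
(** * Transpositions on functions of high degree *)

Section HighDegree.
Context {R : realType} {n : nat}.
Notation rho := (@rho R 'S_n.+1).
Notation V := 'rV[R]_#|'S_n.+1|.
Notation deg_proj := (@deg_proj R n).
Notation star := (@star R n).
Notation transp := (@transp R n).
Implicit Types (A C X : {set 'I_n.+1}) (f g h : V) (k : nat).

Lemma starD1 X v w : w \in X -> w != v ->
  star X v = star (X :\ w) v + rho (tperm v w).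
Proof.
move=> wX wv; rewrite /star (bigD1 w) /=; last by rewrite !inE wX wv.
rewrite addrC; congr (_ + _); apply: eq_bigl => u; rewrite !inE.
by rewrite andbC; case: (u != w) => //=; rewrite ?andbF ?andbT.
Qed.

Lemma star_tperm X v w : w \in X -> v \in X ->
  rho (tperm v w) *m star (X :\ v) w = star (X :\ w) v *m rho (tperm v w).
Proof.
move=> wX vX; rewrite star_conj tpermL; congr (_ *m star _ _).
apply/setP => u; rewrite -(tpermK v w u) (mem_imset _ _ perm_inj) !inE.
rewrite tpermK; case: tpermP => [->|->|/eqP uv /eqP uw].
- by rewrite !eqxx.
- by rewrite wX vX eq_sym.
- by rewrite uv uw.
Qed.

(** The relation of the degenerate affine Hecke algebra between the stars at
    [v] and [w]. *)
Lemma star_hecke X v w : w \in X -> v \in X -> w != v ->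
  rho (tperm v w) *m star (X :\ v) w = star X v *m rho (tperm v w) - 1%:M.
Proof.
move=> wX vX wv; rewrite star_tperm // (starD1 wX wv) mulmxDl rho_tperm2.
by rewrite addrK.
Qed.

Lemma star_comm X v w : v \in X -> w \in X -> w != v ->
  star X v *m star (X :\ v) w = star (X :\ v) w *m star X v.
Proof.
move=> vX wX wv; rewrite mulmx_sumr [RHS]mulmx_suml; apply: eq_bigr => u.
rewrite !inE => /and3P[uw uv uX]; rewrite star_conj tpermD //.
congr (_ *m star _ _); apply/setP => y.
rewrite -{1}(tpermK w u y) (mem_imset _ _ perm_inj).
by case: tpermP => // ->; rewrite wX uX.
Qed.

Lemma deg_proj_star k X v f : (k <= n.+1)%N ->
  f *m deg_proj k = 0 -> f *m star X v *m deg_proj k = 0.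
Proof.
move=> kn f0; rewrite mulmx_sumr mulmx_suml big1 // => w _.
by rewrite -mulmxA deg_proj_comm // mulmxA f0 mul0mx.
Qed.

Lemma deg_proj_rho k a f : (k <= n.+1)%N ->
  f *m deg_proj k = 0 -> f *m rho a *m deg_proj k = 0.
Proof. by move=> kn f0; rewrite -mulmxA deg_proj_comm // mulmxA f0 mul0mx. Qed.

(** Contents are smaller than the length of the first row.  By induction on [X]
    all smaller stars obey the bound.  If [b] is an eigenvalue of the star of
    [X] at [v] above the bound, then on its eigenspace the Hecke relation reads
    [s = (b - A)^-1], for [s] a transposition at [v] and [A] the star of the
    remaining positions; as [b - A] is positive and [s^2 = 1], both are the
    identity.  So the eigenvector is invariant under all permutations of [X],
    which has too many elements for a function orthogonal to degree [k]. *)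
Lemma star_high_degree k X v f : (k <= n)%N -> v \in X ->
  f *m deg_proj k = 0 ->
  dot (f *m star X v) f <= (n%:R - k%:R - 1) * dot f f.
Proof.
move=> kn; have kn' := leqW kn.
have [m] := ubnP #|X|; elim: m X v f => // m IH X v f.
rewrite ltnS => Xm vX f0; have [Xk|Xk] := leqP #|X| (n - k).
  apply: le_trans (star_le _ vX) _; apply: ler_wpM2r; first exact: dot_ge0.
  by rewrite lerD2r -natrB // ler_nat.
set x := _ - 1; rewrite leNgt; apply/negP => fx.
have [] := exists_large_eigenvalue (star_sym X v) _ f0 fx.
  by move=> g; exact: deg_proj_star.
move=> b [{fx}g [xb g0 gn0 gB]]; move/eqP: gn0; apply.
suff gX : invar X g.
  apply: (deg_proj_orth_invar _ g0 gX); rewrite kn' andbT.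
  by rewrite cardsCs setCK card_ord; lia.
have fix_tperm w : w \in X -> w != v -> g *m rho (tperm v w) = g.
  move=> wX wv; pose s := rho (tperm v w); pose A := star (X :\ v) w.
  have Ax h : h *m deg_proj k = 0 -> dot (h *m A) h <= x * dot h h.
    apply: IH; last by rewrite !inE wv.
    by apply: leq_trans Xm; rewrite [X in (_ < X)%N](cardsD1 v) vX.
  have inj c h : x < c -> h *m deg_proj k = 0 -> h *m A = c *: h -> h = 0.
    move=> xc h0 hA; have := Ax _ h0; rewrite hA dotZl.
    by apply: contraTeq => hn0; rewrite -ltNge ltr_pM2r // dot_gt0.
  have key h : h *m star X v = b *: h -> h *m s *m A = b *: (h *m s) - h.
    move=> hB; rewrite -mulmxA star_hecke // mulmxBr mulmx1 mulmxA hB.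
    by rewrite -scalemxAl.
  (* g1 = g (b - A); the relation, applied to g1 and to g, shows that the
     transposition maps g1 to g and that g (b - A)^2 = g *)
  pose g1 := b *: g - g *m A.
  have g1B : g1 *m star X v = b *: g1.
    rewrite mulmxBl -scalemxAl gB -[g *m A *m _]mulmxA -star_comm // mulmxA gB.
    by rewrite -scalemxAl -scalerBr.
  have A0 h : h *m deg_proj k = 0 -> h *m A *m deg_proj k = 0.
    exact: deg_proj_star.
  have g10 : g1 *m deg_proj k = 0.
    by rewrite mulmxBl -scalemxAl g0 A0 // scaler0 subrr.
  have s0 h : h *m deg_proj k = 0 -> h *m s *m deg_proj k = 0.
    exact: deg_proj_rho.
  have g1s : g1 *m s = g.
    apply/eqP; rewrite -subr_eq0; apply/eqP; apply: (inj b) => //.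
      by rewrite mulmxBl s0 // g0 subrr.
    rewrite mulmxBl key // scalerBr -addrA -opprD; congr (_ - _).
    by rewrite /g1 subrK.
  have gs : g *m s = g1 by rewrite -g1s -mulmxA rho_tperm2 mulmx1.
  suff : g1 - g = 0 by rewrite gs => /subr0_eq.
  apply: (inj (b + 1)); first by apply: lt_trans xb _; rewrite ltrDl ltr01.
    by rewrite mulmxBl g10 g0 subrr.
  have gA1 : g1 *m A = b *: g1 - g by rewrite -gs key.
  have gA : g *m A = b *: g - g1 by rewrite /g1 opprB addrC subrK.
  clearbody g1; rewrite mulmxBl gA1 gA scalerDl scale1r scalerBr opprB.
  by rewrite [g1 - b *: g]addrC addrACA [- g + g1]addrC.
apply: tperm_invar => u w uX wX.
have fixv y : y \in X -> g *m rho (tperm v y) = g.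
  move=> yX; have [->|yv] := eqVneq y v; last exact: fix_tperm.
  by rewrite tperm1 rho1 mulmx1.
have [->|uw] := eqVneq u w; first by rewrite tperm1 rho1 mulmx1.
have [->|uv] := eqVneq u v; first exact: fixv.
have [->|wv] := eqVneq w v; first by rewrite tpermC; exact: fixv.
have -> : tperm u w = (tperm v w ^ tperm v u)%g.
  by rewrite tpermJ tpermL tpermD // eq_sym.
by rewrite rhoJ tpermV !mulmxA !fixv.
Qed.

Lemma transp_high_degree k f : (k <= n)%N -> f *m deg_proj k = 0 ->
  dot (f *m transp setT) f <= n.+1%:R * (n%:R - k%:R - 1) / 2 * dot f f.
Proof.
move=> kn f0; rewrite dot_transp.
have : \sum_(v in [set: 'I_n.+1]) dot (f *m star setT v) f
    <= \sum_(v in [set: 'I_n.+1]) (n%:R - k%:R - 1) * dot f f.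
  by apply: ler_sum => v vX; exact: star_high_degree.
by rewrite sumr_const cardsT card_ord -[_ *+ n.+1]mulr_natl; lra.
Qed.

Definition symmetrizer A : 'M[R]_#|'S_n.+1| := \sum_(a | perm_on A a) rho a.

Lemma symmetrizer_invar A f : invar A (f *m symmetrizer A).
Proof.
move=> b bA; rewrite -mulmxA mulmx_suml; congr (_ *m _).
rewrite [RHS](reindex_inj (mulIg b)) /=; apply: eq_big => [a|a _].
  apply/idP/idP => aA; first exact: perm_onM.
  by rewrite -(mulgK b a); apply: perm_onM => //; rewrite perm_onV.
by rewrite rhoM.
Qed.

Lemma symmetrizer_dot A f x : invar A x ->
  dot (f *m symmetrizer A) x = #|[set a | perm_on A a]|%:R * dot f x.
Proof.
move=> xA; rewrite mulmx_sumr dot_suml.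
rewrite (eq_bigr (fun=> dot f x)) => [|a aA].
  by rewrite sumr_const mulr_natl cardsE.
by rewrite dot_adj rho_tr xA // perm_onV.
Qed.

(** [1 + star (i |: A) i] runs over coset representatives of the permutations of
    [A] in those of [i |: A]. *)
Lemma star_symmetrizes A i h : i \notin A -> invar A h ->
  invar (i |: A) (h + h *m star (i |: A) i).
Proof.
move=> iA hA b bA.
have -> : h + h *m star (i |: A) i =
    \sum_(w in i |: A) h *m rho (tperm i w).
  rewrite big_setU1 //= tperm1 rho1 mulmx1; congr (_ + _).
  by rewrite mulmx_sumr /star setU1K.
rewrite mulmx_suml [RHS](reindex_inj (@perm_inj _ b)) /=.
apply: eq_big => [w|w wA]; first by rewrite perm_closed.
(* the coset of a permutation modulo Sym A is determined by the image of i *)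
rewrite -mulmxA -rhoM; pose c := (tperm i w * b * tperm i (b w))%g.
have cA : perm_on A c.
  have iwA x : x \in i |: A -> perm_on (i |: A) (tperm i x).
    move=> xA; apply: fintype.subset_trans (tperm_on i x) _.
    by apply/fintype.subsetP => y /set2P[] -> //; rewrite setU11.
  have cU : perm_on (i |: A) c.
    by rewrite !perm_onM ?iwA // perm_closed.
  apply/fintype.subsetP => y; rewrite inE => cy.
  have := fintype.subsetP cU y; rewrite !inE => /(_ cy)/orP[/eqP yi|//].
  by move: cy; rewrite yi !permM tpermL tpermR eqxx.
have -> : (tperm i w * b = c * tperm i (b w))%g by rewrite -mulgA tperm2 mulg1.
by rewrite rhoM mulmxA hA.
Qed.

(** A function of degree exactly [k + 1] that is invariant under all
    permutations of the complement [A] of a set [C] of [k + 1] positions: for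
    [i] in [C], symmetrizing over one position more gives 0, so that the
    transpositions exchanging [i] with a position in [A] sum to [- 1]. *)
Lemma transp_junta C k h : #|C| = k.+1 -> (k <= n)%N ->
    invar (~: C) h -> h *m deg_proj k = 0 ->
  dot (h *m transp setT) h <=
  (n.+1%:R * n%:R / 2 - k.+1%:R * (n.+1%:R - k%:R)) * dot h h.
Proof.
move=> Ck kn hC h0; pose d := dot h h.
pose c v w := dot (h *m rho (tperm v w)) h.
have cC v w : c v w = c w v by rewrite /c tpermC.
have cle v w : c v w <= d by exact: rho_le.
have cA v w : v \notin C -> w \notin C -> c v w = d.
  move=> vC wC; rewrite /c hC //; apply: fintype.subset_trans (tperm_on v w) _.
  by apply/fintype.subsetP => y /set2P[] ->; rewrite inE.
have cstar v : v \in C -> \sum_(w in ~: C) c v w = - d.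
  move=> vC; have vA : v \notin ~: C by rewrite inE vC.
  have : h + h *m star (v |: ~: C) v = 0.
    apply: (@deg_proj_orth_invar _ _ (v |: ~: C) k).
    - rewrite (leqW kn) andbT (_ : ~: _ = C :\ v).
        by move: Ck; rewrite (cardsD1 v) vC add1n => -[->].
      by apply/setP => w; rewrite !inE negb_or negbK.
    - by rewrite mulmxDl h0 deg_proj_star // ?addr0 // leqW.
    - exact: star_symmetrizes.
  move/(congr1 (fun u => dot u h)); rewrite dotDl dot0l mulmx_sumr dot_suml.
  by rewrite setU1K // -/d => /eqP; rewrite addrC addr_eq0 => /eqP.
rewrite dot_transp.
have -> : \sum_(v in [set: 'I_n.+1]) dot (h *m star setT v) h =
  \sum_v \sum_w c v w - n.+1%:R * d.
  rewrite (eq_bigr (fun v => \sum_w c v w - d)) => [|v _].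
    rewrite big_split /=; congr (_ + _).
      by apply: eq_bigl => v; rewrite inE.
    by rewrite sumr_const cardsT card_ord mulNrn mulr_natl.
  rewrite mulmx_sumr dot_suml [in RHS](bigD1 v) //= /c tperm1 rho1 mulmx1 -/d.
  by rewrite [RHS]addrC addKr; apply: eq_bigl => w; rewrite !inE andbT.
have splitC F : \sum_(v : 'I_n.+1) F v =
    \sum_(v in C) F v + \sum_(v in ~: C) F v :> R.
  rewrite (bigID (mem C)) /=; congr (_ + _).
  by apply: eq_bigl => v; rewrite inE.
have sCA : \sum_(v in C) \sum_(w in ~: C) c v w = - k.+1%:R * d.
  rewrite (eq_bigr (fun=> - d)) => [|v]; last exact: cstar.
  by rewrite sumr_const Ck mulNrn mulNr mulr_natl.
have sAC : \sum_(v in ~: C) \sum_(w in C) c v w = - k.+1%:R * d.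
  rewrite exchange_big -sCA; apply: eq_bigr => v _.
  by apply: eq_bigr => w _; exact: cC.
have sAA : \sum_(v in ~: C) \sum_(w in ~: C) c v w = (n%:R - k%:R) ^+ 2 * d.
  rewrite (eq_bigr (fun v => (n%:R - k%:R) * d)) => [|v vC].
    rewrite sumr_const cardsCs setCK card_ord Ck subSS.
    by rewrite -[_ *+ (n - k)]mulr_natl natrB // mulrA.
  rewrite (eq_bigr (fun=> d)) => [|w wC].
    by rewrite sumr_const cardsCs setCK card_ord Ck subSS -natrB // mulr_natl.
  by apply: cA; rewrite -in_setC.
have sCC : \sum_(v in C) \sum_(w in C) c v w <= k.+1%:R ^+ 2 * d.
  have : \sum_(v in C) \sum_(w in C) c v w <= \sum_(v in C) \sum_(w in C) d.
    by apply: ler_sum => v _; apply: ler_sum => w _.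
  by rewrite !sumr_const Ck expr2 -mulrA !mulr_natl.
have -> : \sum_v \sum_w c v w =
    \sum_(v in C) \sum_(w in C) c v w - k.+1%:R * d
    + (- k.+1%:R * d + (n%:R - k%:R) ^+ 2 * d).
  rewrite splitC (eq_bigr _ (fun v _ => splitC (c v))) big_split /= sCA.
  rewrite [X in _ + X](eq_bigr _ (fun v _ => splitC (c v))) big_split /= sAC.
  by rewrite sAA mulNr.
have calc (e t p q : R) : t <= (q + 1) ^+ 2 * e ->
    2^-1 * (t - (q + 1) * e + (- (q + 1) * e + (p - q) ^+ 2 * e) - (p + 1) * e)
    <= ((p + 1) * p / 2 - (q + 1) * ((p + 1) - q)) * e by lra.
by move: sCC; rewrite -/d -[n.+1%:R]natr1 -[k.+1%:R]natr1; exact: calc.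
Qed.

(** An eigenfunction in degree exactly [k + 1] is not orthogonal to all
    functions of the contents of [k + 1] positions.  Symmetrizing it over the
    other positions keeps the eigenvalue, [transp setT] being central, and gives
    a nonzero function to which the preceding bound applies. *)
Lemma transp_degree k f : (k <= n)%N ->
    f *m deg_proj k.+1 = f -> f *m deg_proj k = 0 ->
  dot (f *m transp setT) f <=
  (n.+1%:R * n%:R / 2 - k.+1%:R * (n.+1%:R - k%:R)) * dot f f.
Proof.
move=> kn f1 f0; rewrite leNgt; apply/negP => fT.
have [||b [g [bg gC gn0 gT]]] := exists_large_eigenvalue
  (C := row_mx (deg_proj k) (1%:M - deg_proj k.+1)) (transp_sym setT) _ _ fT.
- move=> g; rewrite !mul_mx_row => gC.
  have : row_mx (g *m deg_proj k) (g *m (1%:M - deg_proj k.+1)) = row_mx 0 0.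
    by rewrite gC row_mx0.
  case/eq_row_mx => g0; rewrite mulmxBr mulmx1 => /subr0_eq/esym g1.
  have comm j : (j <= n.+1)%N ->
      transp setT *m deg_proj j = deg_proj j *m transp setT.
    move=> jn; rewrite -scalemxAl -scalemxAr; congr (_ *: _).
    rewrite mulmx_suml mulmx_sumr; apply: eq_bigr => v _.
    rewrite mulmx_suml mulmx_sumr; apply: eq_bigr => w _.
    exact: deg_proj_comm.
  rewrite mulmxBr mulmx1 -!mulmxA (comm k (leqW kn)) (comm k.+1 kn) !mulmxA.
  rewrite g0 g1 mul0mx subrr.
  by rewrite row_mx0.
- by rewrite mul_mx_row f0 mulmxBr mulmx1 f1 subrr row_mx0.
have : row_mx (g *m deg_proj k) (g *m (1%:M - deg_proj k.+1)) = row_mx 0 0.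
  by rewrite -mul_mx_row gC row_mx0.
case/eq_row_mx => g0; rewrite mulmxBr mulmx1 => /subr0_eq/esym g1.
have [C [x [Ck xC gx]]] := deg_proj_witness g1 gn0.
pose h := g *m symmetrizer (~: C).
have hn0 : h != 0.
  apply: contraNneq gx => hz; have := symmetrizer_dot g xC.
  rewrite -/h hz dot0l => /esym/eqP; rewrite mulf_eq0 pnatr_eq0 -leqn0 leqNgt.
  rewrite card_gt0; case: eqVneq => //= /setP/(_ 1%g); rewrite !inE.
  by rewrite perm_on1.
have h0 : h *m deg_proj k = 0.
  rewrite /h mulmx_sumr mulmx_suml big1 // => a _.
  exact: (deg_proj_rho _ (leqW kn)).
have hT : h *m transp setT = b *: h.
  rewrite /h scalemxAl -gT -!mulmxA; congr (_ *m _).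
  rewrite mulmx_suml mulmx_sumr; apply: eq_bigr => a _.
  by rewrite transpT_comm.
have := transp_junta Ck kn (@symmetrizer_invar (~: C) g) h0.
by rewrite hT dotZl leNgt ltr_pM2r ?dot_gt0 // bg.
Qed.

End HighDegree.
(** * The trace bound *)

Section Trace.
Context {R : realType} {n : nat}.
Notation rho := (@rho R 'S_n.+1).
Notation V := 'rV[R]_#|'S_n.+1|.
Notation M := 'M[R]_#|'S_n.+1|.
Notation deg_proj := (@deg_proj R n).
Notation P := (@r2r_mx R n).
Implicit Types (f g : V) (k d t : nat).

(** A lower bound for the spectral gap in degree [d], for [m] cards.  The first
    term matters for small degrees, where it is close to [d m], and the second
    one for large degrees, where the first one degenerates. *)
Definition gap (m d : nat) : R :=
  Num.max (d%:R * (m.+1%:R - d%:R)) (m%:R * d%:R / 2) / m%:R ^+ 2.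

Let N2_gt0 : 0 < n.+1%:R ^+ 2 :> R.
Proof. by rewrite exprn_gt0 // ltr0n. Qed.

Lemma r2r_majorant f :
  n.+1%:R ^+ 2 * dot (f *m P) f <= dot (f *m majorant n) f.
Proof.
rewrite -dotZl scalemxAr -natrX r2r_factor; exact: to_last_le.
Qed.

Lemma dot_majorant f : dot (f *m majorant n) f =
  n.+1%:R * (n%:R + 2) / 2 * dot f f + dot (f *m transp setT) f.
Proof.
rewrite mulmxDr mul_mx_scalar dotDl dotZl init_max; congr (_ * _ + _).
by rewrite natrM -[n.+2%:R]natr1 -[n.+1%:R]natr1 -addrA.
Qed.

Lemma r2r_degree k f : (k <= n)%N ->
    f *m deg_proj k.+1 = f -> f *m deg_proj k = 0 ->
  dot (f *m P) f <= (1 - gap n.+1 k.+1) * dot f f.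
Proof.
move=> kn f1 f0; rewrite -(ler_pM2l N2_gt0); apply: le_trans (r2r_majorant f) _.
rewrite dot_majorant /gap mulrA mulrBr mulr1 mulrCA divff ?gt_eqF // mulr1.
have low := transp_degree kn f1 f0; have high := transp_high_degree kn f0.
move: low high; rewrite -[n.+2%:R]natr1 -[n.+1%:R]natr1 -[k.+1%:R]natr1.
move: (dot (f *m transp setT) f) (dot f f) n%:R k%:R => t e x y low high.
by rewrite maxEle; case: ifP => _; lra.
Qed.

Lemma r2r_contract f : dot (f *m P) f <= dot f f.
Proof.
rewrite -(ler_pM2l N2_gt0); apply: le_trans (r2r_majorant f) _.
rewrite dot_majorant; have := transp_le setT f; rewrite cardsT card_ord.
rewrite -[n.+1%:R]natr1.
by move: (dot (f *m transp setT) f) (dot f f) n%:R => t e x; lra.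
Qed.

Lemma r2r_sym : P^T = P.
Proof.
have /eqP : n.+1%:R ^+ 2 *: P^T = n.+1%:R ^+ 2 *: P.
  by rewrite -linearZ /= -natrX r2r_factor trmx_mul trmxK.
by rewrite (inj_eq (scalerI _)) ?gt_eqF // => /eqP.
Qed.

Lemma r2r_comm d : (d <= n.+1)%N -> P *m deg_proj d = deg_proj d *m P.
Proof.
move=> dn; have cB : to_last n *m deg_proj d = deg_proj d *m to_last n.
  rewrite to_last_max mulmx_suml mulmx_sumr; apply: eq_bigr => i _.
  exact: deg_proj_comm.
have cBT : (to_last n)^T *m deg_proj d = deg_proj d *m (to_last n)^T.
  by rewrite -deg_proj_sym -!trmx_mul cB.
have /eqP : n.+1%:R ^+ 2 *: (P *m deg_proj d) =
            n.+1%:R ^+ 2 *: (deg_proj d *m P).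
  rewrite scalemxAl scalemxAr -natrX r2r_factor.
  by rewrite -mulmxA cBT !mulmxA cB.
by rewrite (inj_eq (scalerI _)) ?gt_eqF // => /eqP.
Qed.

Lemma r2r_form f g :
  n.+1%:R ^+ 2 * dot (f *m P) g = dot (f *m to_last n) (g *m to_last n).
Proof.
rewrite -dotZl scalemxAr -natrX r2r_factor.
by rewrite mulmxA dot_adjT.
Qed.

(** Since [P] is a positive form, the bound on the form gives a bound on the
    operator norm. *)
Lemma r2r_norm f r : 0 <= r ->
    dot (f *m P) f <= r * dot f f ->
    dot (f *m P *m P) (f *m P) <= r * dot (f *m P) (f *m P) ->
  dot (f *m P) (f *m P) <= r ^+ 2 * dot f f.
Proof.
move=> r0 h1 h2; set g := f *m P in h2 *.
have [->|g0] := eqVneq g 0; first by rewrite dot0l mulr_ge0 ?sqr_ge0 ?dot_ge0.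
have gg : 0 < dot g g by rewrite dot_gt0.
have := dot_cauchy (f *m to_last n) (g *m to_last n); rewrite -!r2r_form.
rewrite exprMn [leRHS]mulrACA -[n.+1%:R ^+ 2 * _]expr2.
rewrite ler_pM2l ?exprn_gt0 // -/g => cs.
rewrite -(ler_pM2r gg) -expr2; apply: le_trans cs _.
have -> : r ^+ 2 * dot f f * dot g g = (r * dot f f) * (r * dot g g) by ring.
apply: ler_pM => //; rewrite -(pmulr_rge0 _ N2_gt0) r2r_form; exact: dot_ge0.
Qed.

Lemma r2r_norm_pow (K : V -> Prop) r t f : 0 <= r ->
    (forall g, K g -> K (g *m P) /\ dot (g *m P) g <= r * dot g g) -> K f ->
  dot (f *m P ^+ t) (f *m P ^+ t) <= r ^+ (2 * t) * dot f f.
Proof.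
move=> r0 KP; elim: t f => [|t IH] f Kf.
  by rewrite muln0 !expr0 mulmx1 mul1r.
have [Kg fP] := KP _ Kf; have [_ gP] := KP _ Kg.
rewrite exprS [f *m _]mulmxA; apply: le_trans (IH _ Kg) _.
rewrite mulnS exprD [r ^+ 2 * _]mulrC -mulrA ler_wpM2l ?exprn_ge0 //.
exact: r2r_norm.
Qed.

Lemma deg_proj_nestedT k : (k <= n)%N ->
  deg_proj k.+1 *m deg_proj k = deg_proj k.
Proof.
move=> kn; have : deg_proj k *m deg_proj k.+1 = deg_proj k.
  by apply: deg_proj_nested; rewrite leqnSn.
by move/(congr1 trmx); rewrite trmx_mul !deg_proj_sym.
Qed.

Definition deg_part d : M :=
  if d is k.+1 then deg_proj d - deg_proj k else deg_proj 0.

Lemma deg_part_sym d : (deg_part d)^T = deg_part d.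
Proof. by case: d => [|k]; rewrite /= ?linearB /= !deg_proj_sym. Qed.

Lemma deg_part_idem d : (d <= n.+1)%N -> deg_part d *m deg_part d = deg_part d.
Proof.
case: d => [|k] kn /=; first exact: deg_proj_idem.
have e1 : deg_proj k *m deg_proj k.+1 = deg_proj k.
  by apply: deg_proj_nested; rewrite leqnSn.
have e2 : deg_proj k.+1 *m deg_proj k = deg_proj k.
  exact: deg_proj_nestedT.
by rewrite mulmxBl !mulmxBr !deg_proj_idem e1 e2 subrr subr0.
Qed.

Lemma deg_part_sum : \sum_(d < n.+2) deg_part d = 1%:M.
Proof.
rewrite big_ord_recl /= -deg_proj_full.
rewrite (eq_bigr (fun i : 'I_n.+1 => deg_proj i.+1 - deg_proj i)) //.
rewrite -(big_mkord xpredT (fun i => deg_proj i.+1 - deg_proj i)).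
by rewrite telescope_sumr // addrC subrK.
Qed.

Lemma tr_mulmxT (A : M) : \tr (A *m A^T) = \sum_i dot (row i A) (row i A).
Proof.
apply: eq_bigr => i _; rewrite mxE dotE.
by apply: eq_bigr => j _; rewrite !mxE.
Qed.

Lemma deg_part_tr d : (d <= n.+1)%N ->
  0 <= \tr (deg_part d) <= ('C(n.+1, d) * n.+1 ^ d)%:R.
Proof.
move=> dn; have ge0 : 0 <= \tr (deg_part d).
  rewrite -(deg_part_idem dn) -{2}(deg_part_sym d) tr_mulmxT.
  by apply: sumr_ge0 => i _; exact: dot_ge0.
rewrite ge0; apply: le_trans (deg_proj_tr d); case: d dn {ge0} => [|k] dn //=.
rewrite raddfB /= lerBlDr lerDl -(deg_proj_idem k) -{2}(deg_proj_sym k).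
by rewrite tr_mulmxT; apply: sumr_ge0 => i _; exact: dot_ge0.
Qed.

Lemma deg_part_comm d : (d <= n.+1)%N -> P *m deg_part d = deg_part d *m P.
Proof.
case: d => [|k] kn /=; first exact: r2r_comm.
by rewrite mulmxBl mulmxBr !r2r_comm // ltnW.
Qed.

Lemma r2r_pow_sym t : (P ^+ t)^T = P ^+ t.
Proof.
elim: t => [|t IH]; first by rewrite expr0 [LHS]trmx1.
by rewrite {1}exprSr [LHS]trmx_mul IH r2r_sym exprS.
Qed.

Lemma deg_part_pow_tr d t r : (d <= n.+1)%N -> 0 <= r ->
    (forall f, f *m deg_part d = f -> dot (f *m P) f <= r * dot f f) ->
  \tr (deg_part d *m P ^+ (2 * t)) <=
  ('C(n.+1, d) * n.+1 ^ d)%:R * r ^+ (2 * t).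
Proof.
move=> dn r0 rP; set Q := deg_part d.
have -> : \tr (Q *m P ^+ (2 * t)) = \tr ((Q *m P ^+ t) *m (Q *m P ^+ t)^T).
  rewrite trmx_mul deg_part_sym r2r_pow_sym mulmxA [RHS]mxtrace_mulC !mulmxA.
  by rewrite deg_part_idem // mul2n -addnn exprD -mulmxA.
rewrite tr_mulmxT.
have row_le i : dot (row i (Q *m P ^+ t)) (row i (Q *m P ^+ t)) <=
    r ^+ (2 * t) * dot (row i Q) (row i Q).
  rewrite row_mul; apply: (@r2r_norm_pow (fun f => f *m Q = f)) => //.
    move=> g gQ; split; last exact: rP.
    by rewrite -mulmxA deg_part_comm // mulmxA gQ.
  by rewrite -row_mul deg_part_idem.
apply: le_trans (ler_sum _ (fun i _ => row_le i)) _.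
rewrite -mulr_sumr -tr_mulmxT deg_part_sym deg_part_idem // mulrC.
by rewrite ler_wpM2r ?exprn_ge0 //; case/andP: (deg_part_tr dn).
Qed.

Lemma r2r_pow_tr t : \tr (P ^+ (2 * t)) <=
  1 + \sum_(k < n.+1)
        ('C(n.+1, k.+1) * n.+1 ^ k.+1)%:R * expR (- gap n.+1 k.+1) ^+ (2 * t).
Proof.
rewrite -[P ^+ _]mul1mx -deg_part_sum mulmx_suml raddf_sum /= big_ord_recl.
apply: lerD.
  have := @deg_part_pow_tr 0 t 1 (leq0n _) ler01.
  rewrite bin0 expn0 muln1 expr1n mulr1; apply => f _.
  by rewrite mul1r; exact: r2r_contract.
apply: ler_sum => k _; apply: (@deg_part_pow_tr k.+1); rewrite ?expR_ge0 //.
move=> f fQ; have kn : (k <= n)%N by rewrite -ltnS.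
have f0 : f *m deg_proj k = 0.
  rewrite -fQ /= mulmxBr mulmxBl -!mulmxA deg_proj_idem.
  by rewrite deg_proj_nestedT // subrr.
have f1 : f *m deg_proj k.+1 = f.
  by move: fQ; rewrite /= mulmxBr f0 subr0.
apply: le_trans (r2r_degree kn f1 f0) _; rewrite ler_wpM2r ?dot_ge0 //.
exact: expR_ge1Dx.
Qed.

End Trace.
(** * From the trace to the total variation distance *)

Section TotalVariation.
Context {R : realType} {n : nat}.
Notation rho := (@rho R 'S_n.+1).
Notation M := 'M[R]_#|'S_n.+1|.
Notation P := (@r2r_mx R n).

Definition left_invariant (A : M) := forall a x y : 'S_n.+1,
  A (enum_rank (a * x)%g) (enum_rank (a * y)%g) = A (enum_rank x) (enum_rank y).

Lemma left_invariant_rho a : left_invariant (rho a).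
Proof.
move=> b x y; rewrite !mxE !enum_rankK -mulgA.
by rewrite (inj_eq (mulgI b)).
Qed.

Lemma left_invariant_mul (A B : M) :
  left_invariant A -> left_invariant B -> left_invariant (A *m B).
Proof.
move=> hA hB a x y; rewrite !mxE.
rewrite (reindex _ (onW_bij _ (enum_rank_bij _))) /=.
rewrite [RHS](reindex _ (onW_bij _ (enum_rank_bij _))) /=.
rewrite (reindex_inj (mulgI a)) /=.
by apply: eq_bigr => z _; rewrite hA hB.
Qed.

Lemma left_invariant_r2r t : left_invariant (P ^+ t).
Proof.
elim: t => [|t IH].
  move=> a x y; rewrite expr0 !mxE !(inj_eq enum_rank_inj).
  by rewrite (inj_eq (mulgI a)).
rewrite exprS; apply: left_invariant_mul IH => a x y.
have hB : left_invariant (to_last n : M).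
  rewrite to_last_max => b u v; rewrite !summxE.
  by apply: eq_bigr => i _; exact: left_invariant_rho.
have hBT : left_invariant (to_last n : M)^T.
  by move=> b u v; rewrite !mxE; exact: hB.
have := left_invariant_mul hB hBT a x y; rewrite -r2r_factor !mxE.
by apply: mulfI; rewrite pnatr_eq0 -lt0n expn_gt0.
Qed.

Lemma r2r_pow_diag t x : #|'S_n.+1|%:R * (P ^+ t) (enum_rank x) (enum_rank x) =
  \tr (P ^+ t).
Proof.
rewrite /mxtrace (eq_bigr (fun=> (P ^+ t) (enum_rank x) (enum_rank x))).
  by rewrite sumr_const card_ord mulr_natl.
move=> i _; have := left_invariant_r2r t (enum_val i * x^-1)%g x x.
by rewrite mulgKV enum_valK.
Qed.

Lemma r2r_pow_row_sum t i : \sum_j (P ^+ t) i j = 1.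
Proof.
pose ones : 'cV[R]_#|'S_n.+1| := const_mx 1.
have E (A : M) k : \sum_j A k j = (A *m ones) k 0.
  by rewrite mxE; apply: eq_bigr => j _; rewrite mxE mulr1.
have rho_ones a : rho a *m ones = ones.
  apply/matrixP => k z; rewrite !mxE (bigD1 (enum_rank (enum_val k * a)%g)) //=.
  rewrite !mxE enum_rankK eqxx mulr1 big1 ?addr0 // => j jk.
  rewrite !mxE -[j]enum_valK enum_rankK (_ : (_ == _) = false) ?mul0r //.
  by apply/negbTE; apply: contraNneq jk => <-; rewrite enum_valK.
have B_ones : to_last n *m ones = n.+1%:R *: ones.
  rewrite to_last_max mulmx_suml (eq_bigr (fun=> ones)) => [|a _].
    by rewrite sumr_const card_ord scaler_nat.
  exact: rho_ones.
have BT_ones : (to_last n)^T *m ones = n.+1%:R *: ones.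
  rewrite to_last_max raddf_sum mulmx_suml (eq_bigr (fun=> ones)) => [|a _].
    by rewrite sumr_const card_ord scaler_nat.
  by rewrite /= rho_tr; exact: rho_ones.
have P_ones : P *m ones = ones.
  have /eqP : (n.+1 ^ 2)%:R *: (P *m ones) = (n.+1 ^ 2)%:R *: ones.
    rewrite scalemxAl r2r_factor -mulmxA BT_ones -scalemxAr B_ones scalerA.
    by rewrite natrX.
  by rewrite (inj_eq (scalerI _)) ?pnatr_eq0 ?expn_eq0 // => /eqP.
rewrite E; elim: t => [|t IH]; first by rewrite expr0 mul1mx mxE.
by rewrite exprSr -mulmxA P_ones.
Qed.

(** By Cauchy-Schwarz the distance is controlled by the return probability
    [P^(2 t)(x, x)], which by the left invariance of [P] is the same for all [x]
    and hence the normalised trace. *)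
Lemma tv_dist_trace t x :
  tv_dist (kernel_pow (@random_to_random R n.+1) t x) (@uniform_dist R _) ^+ 2
  <= (\tr (P ^+ (2 * t)) - 1) / 4.
Proof.
set N : R := #|'S_n.+1|%:R.
have N0 : 0 < N by rewrite ltr0n; apply/card_gt0P; exists 1%g.
pose u : 'rV[R]_#|'S_n.+1| := \row_j `|(P ^+ t) (enum_rank x) j - N^-1|.
pose ones : 'rV[R]_#|'S_n.+1| := const_mx 1.
have -> : tv_dist (kernel_pow (@random_to_random R n.+1) t x)
            (@uniform_dist R _) = 2^-1 * dot u ones.
  rewrite /tv_dist dotE (reindex _ (onW_bij _ (enum_rank_bij _))) /=.
  congr (_ * _); apply: eq_bigr => y _.
  by rewrite kernel_powE /uniform_dist !mxE mulr1.
have oo : dot ones ones = N.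
  rewrite dotE (eq_bigr (fun=> 1)) => [|j _]; last by rewrite !mxE mulr1.
  by rewrite sumr_const card_ord.
have uu : dot u u = (P ^+ (2 * t)) (enum_rank x) (enum_rank x) - N^-1.
  rewrite dotE (eq_bigr (fun j => (P ^+ t) (enum_rank x) j ^+ 2
      - (P ^+ t) (enum_rank x) j * (2 * N^-1) + N^-1 ^+ 2)); last first.
    move=> j _.
    by rewrite !mxE -expr2 real_normK ?num_real // sqrrB -mulr_natr; ring.
  rewrite !big_split /= sumrN -mulr_suml r2r_pow_row_sum sumr_const card_ord.
  have -> : \sum_j (P ^+ t) (enum_rank x) j ^+ 2 =
      (P ^+ (2 * t)) (enum_rank x) (enum_rank x).
    rewrite mul2n -addnn exprD mxE; apply: eq_bigr => j _.
    by rewrite expr2 -{2}(r2r_pow_sym t) mxE.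
  have -> : N^-1 ^+ 2 *+ #|'S_n.+1| = N^-1.
    by rewrite -[LHS]mulr_natr -/N expr2 mulfVK ?gt_eqF.
  by ring.
have := dot_cauchy u ones; rewrite oo uu => h.
rewrite exprMn -(r2r_pow_diag (2 * t) x) -/N.
have -> : N * (P ^+ (2 * t)) (enum_rank x) (enum_rank x) - 1 =
    ((P ^+ (2 * t)) (enum_rank x) (enum_rank x) - N^-1) * N.
  by rewrite mulrBl mulVf ?gt_eqF // mulrC.
by lra.
Qed.

End TotalVariation.
(** * The mixing time *)

Section Asymptotics.
Context {R : realType}.
Implicit Types (m k t : nat) (q : R).

Lemma bin_le_exp m k : ('C(m, k) <= m ^ k)%N.
Proof.
elim: k m => [|k IH] [|m]; rewrite ?bin0 ?bin0n //.
apply: (@leq_trans (k.+1 * 'C(m.+1, k.+1))); first by rewrite leq_pmull.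
rewrite -mul_bin_diag expnS leq_mul2l /=; apply: leq_trans (IH m) _.
by case: k {IH} => // k; rewrite leq_exp2r.
Qed.

Lemma bin_le_2exp m k : ('C(m, k) <= 2 ^ m)%N.
Proof.
rewrite -[X in 'C(X, k)](card_ord m) -card_draws -[X in (2 ^ X)%N](card_ord m).
by rewrite -cardsT -card_powerset powersetT cardsT max_card.
Qed.

Lemma sum_geometric q m : 0 <= q <= 2^-1 -> \sum_(k < m) q ^+ k.+1 <= 2 * q.
Proof.
case/andP => q0 q1.
suff : \sum_(k < m) q ^+ k.+1 <= 2 * q - 2 * q ^+ m.+1.
  have := exprn_ge0 m.+1 q0; lra.
elim: m => [|m IH]; first by rewrite big_ord0 expr1 subrr.
rewrite big_ord_recr /=; have := exprn_ge0 m.+1 q0 => p0.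
apply: le_trans (lerD IH (lexx _)) _; rewrite [q ^+ m.+2]exprS.
have : q * q ^+ m.+1 <= 2^-1 * q ^+ m.+1 by rewrite ler_wpM2r.
lra.
Qed.

(** In degree [d <= m / 4] the multiplicity is at most [m ^ (2 d)] and the
    factor at most [m ^ (- 9 d / 4)].  In higher degree they are bounded by
    [2 ^ m * m ^ d] and [m ^ (- 3 d / 2)]; there the factor [2 ^ m <= e ^ m] is
    absorbed by [m ^ (d / 4)], since [m < 4 d] and [ln m >= 16]. *)
Lemma trace_term_le m d t : (0 < d <= m)%N -> 16 <= ln m%:R :> R ->
    3 / 2 * m%:R * ln m%:R <= t%:R :> R ->
  ('C(m, d) * m ^ d)%:R * expR (- gap m d) ^+ (2 * t)
  <= expR (- (ln m%:R / 4)) ^+ d :> R.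
Proof.
case/andP => d0 dm L16 tm; set L : R := ln m%:R.
have m0 : 0 < m%:R :> R by rewrite ltr0n; lia.
have d0' : 0 < d%:R :> R by rewrite ltr0n.
have dm' : d%:R <= m%:R :> R by rewrite ler_nat.
have L0 : 0 < L by apply: lt_le_trans L16; rewrite ltr0n.
have powE k : (m ^ k)%:R = expR (k%:R * L) :> R.
  by rewrite natrX expRM_natl lnK.
pose G : R := Num.max (d%:R * (m.+1%:R - d%:R)) (m%:R * d%:R / 2) / m%:R.
have gapG : gap m d = G / m%:R by rewrite /gap /G expr2 invfM mulrA.
have factor : expR (- gap m d) ^+ (2 * t) <= expR (- (3 * G * L)).
  rewrite -expRM_natl ler_expR mulrN lerN2 gapG natrM.
  have G0 : 0 <= G.
    apply: divr_ge0 => //; by rewrite le_max orbC divr_ge0 ?mulr_ge0.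
  rewrite [leRHS]mulrA ler_pdivlMr //.
  have : 3 / 2 * m%:R * L * (2 * G) <= t%:R * (2 * G).
    by rewrite ler_wpM2r ?mulr_ge0.
  lra.
have Gm : G * m%:R = Num.max (d%:R * (m.+1%:R - d%:R)) (m%:R * d%:R / 2).
  by rewrite /G divfK // gt_eqF.
rewrite -[leRHS]expRM_natl; apply: le_trans (ler_wpM2l (ler0n _ _) factor) _.
rewrite natrM powE.
have [small|large] := leP (4 * d%:R) (m%:R : R).
  have G1 : 3 / 4 * d%:R <= G.
    rewrite -(ler_pM2r m0) Gm le_max; apply/orP; left.
    rewrite mulrAC [_ * d%:R]mulrC ler_pM2l // -[m.+1%:R]natr1.
    by move: small; move: (m%:R : R) (d%:R : R) => x y; lra.
  apply: (@le_trans _ _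
    (expR (d%:R * L) * expR (d%:R * L) * expR (- (3 * G * L)))).
    rewrite ler_wpM2r ?expR_ge0 // ler_wpM2r ?expR_ge0 // -powE ler_nat.
    exact: bin_le_exp.
  rewrite -!expRD ler_expR.
  have : 3 / 4 * d%:R * L <= G * L by rewrite ler_wpM2r // ltW.
  have : 0 <= d%:R * L by rewrite mulr_ge0 ?ltW.
  lra.
have G1 : d%:R / 2 <= G.
  by rewrite -(ler_pM2r m0) Gm le_max; apply/orP; right; lra.
apply: (@le_trans _ _ (expR m%:R * expR (d%:R * L) * expR (- (3 * G * L)))).
  rewrite ler_wpM2r ?expR_ge0 // ler_wpM2r ?expR_ge0 //.
  apply: (@le_trans _ _ ((2 ^ m)%:R)); first by rewrite ler_nat bin_le_2exp.
  rewrite natrX -[m%:R]mulr1 expRM_natl lerXn2r ?nnegrE ?expR_ge0 //.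
  by apply: le_trans (expR_ge1Dx 1); lra.
rewrite -!expRD ler_expR.
have : d%:R / 2 * L <= G * L by rewrite ler_wpM2r // ltW.
have : d%:R * 16 <= d%:R * L by rewrite ler_wpM2l // ltW.
lra.
Qed.

Lemma mixed_random_to_random (eps : R) n t : 0 < eps ->
    16 <= ln n.+1%:R :> R -> 2 / eps ^+ 2 <= ln n.+1%:R ->
    3 / 2 * n.+1%:R * ln n.+1%:R <= t%:R :> R ->
  mixed (@random_to_random R n.+1) eps t.
Proof.
move=> e0 L16 Le tm; apply/forallP => x; set L : R := ln _ in L16 Le tm.
pose q := expR (- (L / 4)).
have L0 : 0 < L by apply: lt_le_trans L16; rewrite ltr0n.
have qL : q <= 4 / L.
  rewrite /q expRN -[4 / L]invrK invfM invrK.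
  rewrite lef_pV2 ?posrE ?expR_gt0 ?mulr_gt0 ?invr_gt0 // mulrC.
  by apply: le_trans (expR_ge1Dx _); rewrite lerDr.
have L2 : L^-1 <= 16^-1 by rewrite lef_pV2 ?posrE.
have q2 : 0 <= q <= 2^-1.
  by rewrite expR_ge0 /=; apply: le_trans qL _; lra.
have qe : q / 2 <= eps ^+ 2.
  have : 2 / L <= eps ^+ 2.
    by rewrite ler_pdivrMr // mulrC -ler_pdivrMr ?exprn_gt0.
  lra.
have tr_le : \tr (r2r_mx ^+ (2 * t) : 'M[R]_#|'S_n.+1|) <= 1 + 2 * q.
  apply: le_trans (r2r_pow_tr t) _; rewrite lerD2l.
  apply: le_trans (sum_geometric n.+1 q2); apply: ler_sum => k _.
  by apply: trace_term_le => //=; rewrite ltn_ord.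
rewrite -(@ler_pXn2r _ 2) ?nnegrE ?(ltW e0) //; last first.
  by rewrite mulr_ge0 ?invr_ge0 ?sumr_ge0.
by apply: le_trans (tv_dist_trace t x) _; lra.
Qed.

Lemma mixing_time_le (V : finType) (P : V -> V -> R) eps t :
  mixed P eps t -> (mixing_time P eps <= t%:R%:E)%E.
Proof.
rewrite /mixing_time => mt; case: pselect => [h|]; last by case; exists t.
by case: ex_minnP => k _ /(_ t mt) kt; rewrite lee_fin ler_nat.
Qed.

(** The bound holds with 3/2 in place of 1.5324; the difference absorbs the
    rounding up of the number of steps. *)
Lemma mixing_time_random_to_random (eps : R) n : 0 < eps ->
    16 <= ln n.+1%:R :> R -> 2 / eps ^+ 2 <= ln n.+1%:R ->
  (mixing_time (@random_to_random R n.+1) eps <=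
   (15324 / 10000 * n.+1%:R * ln n.+1%:R)%:E)%E.
Proof.
move=> e0 L16 Le; pose y : R := 3 / 2 * n.+1%:R * ln n.+1%:R.
pose t := (Num.truncn y).+1.
have y0 : 0 <= y by rewrite /y !mulr_ge0 //; apply: le_trans L16.
have ty : t%:R <= y + 1 by rewrite /t -natr1 lerD2r truncn_le.
apply: le_trans (mixing_time_le (t := t) _) _.
  by apply: mixed_random_to_random => //; apply/ltW; exact: truncnS_gt.
rewrite lee_fin; apply: le_trans ty _; rewrite /y.
have n17 : 17 <= n.+1%:R :> R.
  rewrite -(@lnK _ n.+1%:R) ?posrE ?ltr0n //.
  by apply: le_trans (expR_ge1Dx _); lra.
have : 17 * 16 <= n.+1%:R * ln n.+1%:R :> R by apply: ler_pM.
lra.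
Qed.

End Asymptotics.

(** * The theorem *)

Theorem theorem1 (R : realType) (eps : R) (heps : 0 < eps < 1) :
  (limn_esup (fun n : nat =>
     mixing_time (@random_to_random R n) eps
     / (15324 / 10000 * n%:R * ln n%:R)%:E) <= 1)%E.
Proof.
have /andP[e0 _] := heps; pose c : R := Num.max 16 (2 / eps ^+ 2).
have [n0 cn0] : exists n0, expR c < n0%:R.
  by exists (Num.truncn (expR c)).+1; exact: truncnS_gt.
rewrite /limn_esup /limf_esup; set tail_sup := (X in (X @` _)%classic).
apply: (@le_trans _ _ (tail_sup [set n | (n0 <= n)%N]%classic)).
  apply: ereal_inf_lbound; exists [set n | (n0 <= n)%N]%classic => //.
  by exists n0.
apply: ge_ereal_sup => _ [[|n] /= n0n <-].
  by move: cn0; rewrite ltNge (le_trans _ (expR_ge0 c)) // lern0 -leqn0.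
have Lc : c <= ln n.+1%:R.
  rewrite -ler_expR lnK ?posrE ?ltr0n //; apply/ltW.
  by apply: lt_le_trans cn0 _; rewrite ler_nat.
have L16 : 16 <= ln n.+1%:R :> R by apply: le_trans Lc; rewrite le_max lexx.
have Le : 2 / eps ^+ 2 <= ln n.+1%:R :> R.
  by apply: le_trans Lc; rewrite le_max lexx orbT.
have := mixing_time_random_to_random e0 L16 Le.
have : 0 < 15324 / 10000 * n.+1%:R * ln n.+1%:R :> R.
  have n1 : 0 < n.+1%:R :> R by rewrite ltr0n.
  have L0 : 0 < ln n.+1%:R :> R by apply: lt_le_trans L16; rewrite ltr0n.
  have K0 : 0 < 15324 / 10000 :> R by lra.
  exact: mulr_gt0 (mulr_gt0 K0 n1) L0.
move: (_ * ln _) => y y0 h.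
by rewrite inver gt_eqF // lee_pdivrMr // mul1e.
Qed.
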